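(* Let $(K,v)$ be a valued field of rank 1 and $(F|K,v)$ an immediate function field of transcendence degree 1. Suppose there is some $x\in F^h\setminus K^c$ whose approximation type over $K$ is transcendental and such that $F^h=K(x)^h$. Then there is already some $y\in F$ such that $F^h=K(y)^h$. In fact, there is some $\gamma\in vK$ such that $K(x)^h=K(y)^h$ holds for every $y\in F$ with $v(x-y)\geq\gamma$.
   Context: Valuations are Krull valuations written additively; $vK$ is the value group and $Kv$ the residue field of $(K,v)$. Rank 1 means that $vK$ is nontrivial and archimedean. An extension $(L|K,v)$ is immediate if $vL=vK$ and $Lv=Kv$. A function field $F|K$ of transcendence degree 1 is a finitely generated field extension of transcendence degree 1; it is immediate if $(F|K,v)$ is. An extension of $v$ to the algebraic closure of $F$ is fixed; $E^h$ denotes the henselization, inside it, of a subfield $E$. $K^c$ denotes the completion of $(K,v)$; for $x\in F^h$, $x\notin K^c$ means that there is $\gamma\in vK$ with $v(x-c)<\gamma$ for all $c\in K$. For $\alpha\in vK\cup\{\infty\}$ put $\mathrm{appr}(x,K)_\alpha=\{c\in K\mid v(x-c)\geq\alpha\}$. The approximation type of $x$ over $K$ is the collection $\mathrm{appr}(x,K)$ of all nonempty sets $\mathrm{appr}(x,K)_\alpha$. It is immediate if the intersection of all these sets is empty. ''$\varphi(c)$ for $c\nearrow x$'' means: there is $\alpha\in vK$ with $\mathrm{appr}(x,K)_\alpha\ne\emptyset$ such that $\varphi(c)$ holds for all $c\in\mathrm{appr}(x,K)_\alpha$. $\mathrm{appr}(x,K)$ fixes the value of $g\in K[X]$ if there is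 $\alpha\in vK\cup\{\infty\}$ with $vg(c)=\alpha$ for $c\nearrow x$. An immediate approximation type $\mathrm{appr}(x,K)$ is called transcendental if it fixes the value of every polynomial in $K[X]$. *)

(* Defs.v *)
From HB Require Import structures.
From mathcomp Require Import all_boot all_order all_algebra.
From mathcomp Require Import boolp classical_sets.

Set Implicit Arguments.
Unset Strict Implicit.
Unset Printing Implicit Defensive.

Import Order.TTheory GRing.Theory Num.Theory.
Local Open Scope classical_set_scope.
Local Open Scope ring_scope.

HB.mixin Record POrderedZmodule_isOrderedGroup G of Num.POrderedZmodule G := {
  og_le_total : total (<=%R : rel G);
  og_leD2l : forall z x y : G, x <= y -> z + x <= z + y
}.

(* Totally ordered abelian groups, the codomains of Krull valuations. *)
#[short(type="orderedGroupType")]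
HB.structure Definition OrderedGroup :=
  { G of Num.POrderedZmodule G & POrderedZmodule_isOrderedGroup G }.

(* [option G] stands for G with an added element oo = None above all others. *)
Section Values.
Variable G : orderedGroupType.

Definition vle (a b : option G) : bool :=
  match a, b with
  | _, None => true
  | None, Some _ => false
  | Some a', Some b' => a' <= b'
  end.

Definition vlt (a b : option G) : bool := ~~ vle b a.

Definition vadd (a b : option G) : option G :=
  match a, b with
  | Some a', Some b' => Some (a' + b')
  | _, _ => None
  end.

End Values.

Record valuation (Om : fieldType) (G : orderedGroupType) := Valuation {
  valf :> Om -> option G;
  valf_eq_oo : forall a, valf a = None <-> a = 0;
  valfM : forall a b, valf (a * b) = vadd (valf a) (valf b);
  (* v (a + b) >= min (v a) (v b) *)
  valfD : forall a b, vle (valf a) (valf (a + b)) \/ vle (valf b) (valf (a + b))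
}.

(* All fields are subfields of an ambient field Om; they are valued by the
   restrictions of one valuation v of Om. *)
Section Subfields.
Variable Om : fieldType.
Implicit Types (E K F A : set Om).

Definition subfield E : Prop := GRing.divring_closed (mem E).

Definition adjoin K A : set Om := smallest subfield (K `|` A).

Definition algebraic_over E (a : Om) : Prop :=
  exists p : {poly Om}, [/\ p \is a polyOver (mem E), p != 0 & root p a].

Definition is_algebraic_closure_of F : Prop :=
  GRing.closed_field_axiom Om /\ forall a, algebraic_over F a.

Definition finitely_generated K F : Prop :=
  exists s : seq Om, F = adjoin K [set` s].

Definition trdeg_one K F : Prop :=
  exists t, [/\ F t, ~ algebraic_over K t &
                forall a, F a -> algebraic_over (adjoin K [set t]) a].

Definition function_field_trdeg_one K F : Prop :=
  [/\ subfield F, K `<=` F, finitely_generated K F & trdeg_one K F].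

End Subfields.

Section ValuedSubfields.
Variables (Om : fieldType) (G : orderedGroupType) (v : valuation Om G).
Implicit Types (E K F : set Om).

Definition value_group E : set G := [set g | exists2 a, E a & v a = Some g].

Definition rank_one K : Prop :=
  (exists2 g, value_group K g & g <> 0) /\
  (forall g h, value_group K g -> value_group K h -> 0 < g ->
     exists n : nat, h <= g *+ n).

Definition valuation_ring E : set Om := [set a | E a /\ vle (Some 0) (v a)].

(* The class of a modulo the maximal ideal of the valuation ring of Om. *)
Definition residue (a : Om) : set Om := [set b | vlt (Some 0) (v (b - a))].

(* The residue field of E, canonically embedded in the residue field of Om;
   thus equality of sets expresses that a residue field extension is trivial. *)
Definition residue_field E : set (set Om) := residue @` valuation_ring E.

Definition immediate_ext K F : Prop :=
  value_group F = value_group K /\ residue_field F = residue_field K.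

(* A field is henselian if Hensel's Lemma (lifting of simple residual roots)
   holds in its valuation ring. *)
Definition henselian E : Prop :=
  forall (f : {poly Om}) (a : Om),
    f \is a polyOver (mem (valuation_ring E)) -> valuation_ring E a ->
    vlt (Some 0) (v f.[a]) -> v f^`().[a] = Some 0 ->
    exists b, [/\ valuation_ring E b, root f b & vlt (Some 0) (v (b - a))].

(* If Om is algebraically closed, it contains a smallest henselian subfield
   over E, since a root provided by Hensel's Lemma is unique in Om. *)
Definition henselization E : set Om :=
  smallest [set L | subfield L /\ henselian L] E.

(* x is not in the completion of K: v (x - c) is bounded from above in vK. *)
Definition notin_completion K (x : Om) : Prop :=
  exists2 g, value_group K g & forall c, K c -> vlt (v (x - c)) (Some g).

Definition value_set K : set (option G) :=
  [set a | a = None \/ exists2 g, value_group K g & a = Some g].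

Definition appr_at (x : Om) K (alpha : option G) : set Om :=
  [set c | K c /\ vle alpha (v (x - c))].

Definition appr (x : Om) K : set (set Om) :=
  [set A | A !=set0 /\ exists2 alpha, value_set K alpha & A = appr_at x K alpha].

Definition immediate_appr (x : Om) K : Prop :=
  \bigcap_(A in appr x K) A = set0.

(* phi c holds for all c in K close enough to x; written phi(c) for c /^ x. *)
Definition eventually_appr (x : Om) K (phi : Om -> Prop) : Prop :=
  exists g, [/\ value_group K g, appr_at x K (Some g) !=set0 &
                forall c, appr_at x K (Some g) c -> phi c].

Definition appr_fixes_value (x : Om) K (g : {poly Om}) : Prop :=
  exists2 alpha, value_set K alpha &
    eventually_appr x K (fun c => v g.[c] = alpha).

Definition transcendental_appr (x : Om) K : Prop :=
  immediate_appr x K /\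
  forall g : {poly Om}, g \is a polyOver (mem K) -> appr_fixes_value x K g.

End ValuedSubfields.

(* Main.v *)
(** Choose [d] in [K] with [v (x - c) < v d] for all [c] in [K]. Since the approximation type of [x]
    is transcendental, no polynomial over [K] has a root [a] with [v (x - a) >= v d]; hence on the
    disc [v (z - x) > v d] every polynomial [p] over [K] is nearly constant:
    [p (z + d X) = p z (1 + X m)] with [m] over the maximal ideal.

    Let [y] in [F] satisfy [v (x - y) > v d], and put [L = K(y)^h]. In rank one, [K(x)^h] lies in the
    closure of [K(x)], so [y] is a limit of values [r x] of rational functions [r = A / B] over [K].
    As [r X - X] is small and nearly constant on the disc, Hensel's Lemma solves [r w = y] with [w]
    in [L] and [v (w - x) = v (y - r x)]. So [x] lies in the closure of [L]; being algebraic over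
    [L], it is purely inseparable over the henselian field [L].

    In characteristic [p] it remains to descend from [x^(p^m)] in [L] to [x] in [L]. The field
    [K(x)^h] equals [K(x^p)^h (x)], and [y] is not in [K(x^p)^h]: otherwise [y] is a limit of
    [(A / B) x] with [A' = B' = 0], and [C = A - X B] has derivative [- B], which contradicts near
    constancy of [C]. So [y] is a polynomial in [x] of degree between [1] and [p - 1] over
    [K(x^p)^h]; its [p^j]-th powers give equations of degree [< p] for [x^(p^j)] over [L]. *)
Require Import Defs.
From HB Require Import structures.
From mathcomp Require Import all_boot all_order all_algebra.
From mathcomp Require Import boolp classical_sets.
From mathcomp Require Import ring.

Set Implicit Arguments.
Unset Strict Implicit.
Unset Printing Implicit Defensive.

Import Order.TTheory GRing.Theory Num.Theory.
Local Open Scope classical_set_scope.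
Local Open Scope ring_scope.

(** * The order on values with infinity *)

Section Values.
Variable G : orderedGroupType.
Implicit Types a b c : option G.

Lemma vle_refl a : vle a a.
Proof. by case: a => //= a. Qed.

Lemma vle_trans b a c : vle a b -> vle b c -> vle a c.
Proof. by case: a b c => [a|] [b|] [c|] //=; apply: le_trans. Qed.

Lemma vle_total a b : vle a b || vle b a.
Proof. by case: a b => [a|] [b|] //=; apply: og_le_total. Qed.

Lemma vle_anti a b : vle a b -> vle b a -> a = b.
Proof.
case: a b => [a|] [b|] //= ab ba.
by congr Some; apply: le_anti; rewrite ab.
Qed.

Lemma vltW a b : vlt a b -> vle a b.
Proof. by rewrite /vlt; case/orP: (vle_total a b) => [//|->]. Qed.

Lemma vle_lt_trans b a c : vle a b -> vlt b c -> vlt a c.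
Proof. by move=> ab; apply: contra => ca; apply: vle_trans ca ab. Qed.

Lemma vlt_le_trans b a c : vlt a b -> vle b c -> vlt a c.
Proof. by move=> ab bc; apply: contra ab; apply: vle_trans. Qed.

Lemma vlt_trans b a c : vlt a b -> vlt b c -> vlt a c.
Proof. by move=> /vltW; apply: vle_lt_trans. Qed.

Lemma vle_None a : vle a None.
Proof. by case: a. Qed.

Lemma vle_add2l c a b : vle a b -> vle (vadd c a) (vadd c b).
Proof. by case: a b c => [a|] [b|] [c|] //=; apply: og_leD2l. Qed.

Lemma vlt_add2l g a b : vlt a b -> vlt (vadd (Some g) a) (vadd (Some g) b).
Proof.
case: a b => [a|] [b|] //=; apply: contra => /= h.
by have := og_leD2l (- g) _ _ h; rewrite !addKr.
Qed.

End Values.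

(** * Valuation calculus on elements of the ambient field *)

Section ValuationTheory.
Variables (Om : fieldType) (G : orderedGroupType) (v : valuation Om G).
Implicit Types a b c d : Om.

(** Values are compared through elements that carry them, so that bounds are multiplied and divided
    in [Om] itself; for [a != 0], [val_le a b] means that [b / a] is integral. *)
Definition val_le a b := vle (v a) (v b).
Definition val_lt a b := vlt (v a) (v b).
Local Notation dle := val_le.
Local Notation dlt := val_lt.

Lemma valf0 : v 0 = None.
Proof. exact/valf_eq_oo. Qed.

Lemma valf_neq0 a : a != 0 -> exists g, v a = Some g.
Proof.
move=> /eqP a0; case E: (v a) => [g|]; first by exists g.
by case: a0; apply/(valf_eq_oo v).
Qed.

Lemma valf1 : v 1 = Some 0.
Proof.
have [g vg] := valf_neq0 (oner_neq0 Om).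
have := valfM v 1 1; rewrite mulr1 vg /= => -[] /eqP.
by rewrite -{1}(addr0 g) (inj_eq (addrI _)) => /eqP <-.
Qed.

Lemma valfN1 : v (-1) = Some 0.
Proof.
have [g vg] : exists g, v (-1) = Some g by apply: valf_neq0; rewrite oppr_eq0 oner_neq0.
have := valfM v (-1) (-1); rewrite mulrNN mulr1 valf1 vg /= => -[gg].
(* Since [g + g = 0], adding [g] to either of [g <= 0] and [0 <= g] gives the other. *)
congr Some; apply: le_anti.
case/orP: (og_le_total g 0) => h; have := og_leD2l g _ _ h; rewrite -gg addr0 => h'.
  by rewrite h h'.
by rewrite h h'.
Qed.

Lemma valfN a : v (- a) = v a.
Proof. by rewrite -mulN1r valfM valfN1; case: (v a) => //= g; rewrite add0r. Qed.

Lemma valfBC a b : v (a - b) = v (b - a).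
Proof. by rewrite -opprB valfN. Qed.

Lemma dle_refl a : dle a a. Proof. exact: vle_refl. Qed.
Lemma dle_trans b a c : dle a b -> dle b c -> dle a c.
Proof. exact: vle_trans. Qed.
Lemma dle_lt_trans b a c : dle a b -> dlt b c -> dlt a c.
Proof. exact: vle_lt_trans. Qed.
Lemma dlt_le_trans b a c : dlt a b -> dle b c -> dlt a c.
Proof. exact: vlt_le_trans. Qed.
Lemma dlt_trans b a c : dlt a b -> dlt b c -> dlt a c.
Proof. exact: vlt_trans. Qed.
Lemma dltW a b : dlt a b -> dle a b. Proof. exact: vltW. Qed.
Lemma dle_total a b : dle a b || dle b a. Proof. exact: vle_total. Qed.
Lemma dleNlt a b : dle a b = ~~ dlt b a.
Proof. by rewrite /val_lt /vlt negbK. Qed.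
Lemma dltNle a b : dlt a b = ~~ dle b a. Proof. by []. Qed.
Lemma dltxx a : dlt a a = false.
Proof. by rewrite dltNle dle_refl. Qed.

Lemma dle0 a : dle a 0. Proof. by rewrite /val_le valf0 vle_None. Qed.
Lemma dlt0 a : dlt a 0 = (a != 0).
Proof.
apply/idP/idP; first by apply: contraTneq => ->; rewrite dltxx.
by case/valf_neq0 => g vg; rewrite /val_lt valf0 vg.
Qed.
Lemma dlt_neq0 a b : dlt a b -> a != 0.
Proof. by rewrite -dlt0 => ab; apply: dlt_le_trans ab (dle0 _). Qed.
Lemma dleN c a : dle c (- a) = dle c a. Proof. by rewrite /val_le valfN. Qed.
Lemma dltN c a : dlt c (- a) = dlt c a. Proof. by rewrite /val_lt valfN. Qed.

Lemma dleD c a b : dle c a -> dle c b -> dle c (a + b).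
Proof.
move=> ca cb; rewrite /val_le.
by case: (valfD v a b) => h; apply: (vle_trans _ h).
Qed.
Lemma dleB c a b : dle c a -> dle c b -> dle c (a - b).
Proof. by move=> ca cb; apply: dleD => //; rewrite dleN. Qed.
Lemma dltD c a b : dlt c a -> dlt c b -> dlt c (a + b).
Proof.
move=> ca cb; rewrite /val_lt.
by case: (valfD v a b) => h; apply: (vlt_le_trans _ h).
Qed.
Lemma dltB c a b : dlt c a -> dlt c b -> dlt c (a - b).
Proof. by move=> ca cb; apply: dltD => //; rewrite dltN. Qed.

Lemma valfDl a b : dlt a b -> v (a + b) = v a.
Proof.
move=> ab; apply: vle_anti; last by apply: dleD; [apply: dle_refl | apply: dltW].
rewrite -/(val_le _ _) dleNlt; apply/negP => h.
by have := dltB h ab; rewrite addrK dltxx.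
Qed.
Lemma valfDr a b : dlt b a -> v (a + b) = v b.
Proof. by rewrite addrC; apply: valfDl. Qed.

Lemma dleM2l c a b : dle a b -> dle (c * a) (c * b).
Proof. by rewrite /val_le !valfM; apply: vle_add2l. Qed.
Lemma dleM a b c d : dle a b -> dle c d -> dle (a * c) (b * d).
Proof.
move=> ab cd; apply: dle_trans (dleM2l _ cd) _.
by rewrite ![_ * d]mulrC dleM2l.
Qed.
Lemma dltM2l c a b : c != 0 -> dlt a b -> dlt (c * a) (c * b).
Proof. by case/valf_neq0 => g vg; rewrite /val_lt !valfM vg; apply: vlt_add2l. Qed.
Lemma dltM a b c d : c != 0 -> dlt a b -> dle c d -> dlt (a * c) (b * d).
Proof.
move=> c0 ab cd; apply: (@dlt_le_trans (b * c)); last exact: dleM2l.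
by rewrite ![_ * c]mulrC dltM2l.
Qed.
Lemma dleMK c a b : c != 0 -> dle (c * a) (c * b) = dle a b.
Proof.
by move=> c0; apply/idP/idP; [rewrite !dleNlt; apply: contra; apply: dltM2l | apply: dleM2l].
Qed.
Lemma dltMK c a b : c != 0 -> dlt (c * a) (c * b) = dlt a b.
Proof. by move=> c0; rewrite !dltNle dleMK. Qed.

Lemma dle1M a b : dle 1 a -> dle 1 b -> dle 1 (a * b).
Proof. by move=> ha hb; have := dleM ha hb; rewrite mulr1. Qed.
Lemma dlt1M a b : dlt 1 a -> dle 1 b -> dlt 1 (a * b).
Proof. by move=> ha hb; have := dltM (oner_neq0 _) ha hb; rewrite mulr1. Qed.
Lemma dle_mulr a b : dle 1 b -> dle a (a * b).
Proof. by move=> /(dleM2l a); rewrite mulr1. Qed.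
Lemma dlt_mulr a b : a != 0 -> dlt 1 b -> dlt a (a * b).
Proof. by move=> a0 /(dltM2l a0); rewrite mulr1. Qed.
Lemma dle1X a n : dle 1 a -> dle 1 (a ^+ n).
Proof.
move=> a1; elim: n => [|n IHn]; first by rewrite expr0 dle_refl.
by rewrite exprS dle1M.
Qed.
Lemma dleX a b n : dle a b -> dle (a ^+ n) (b ^+ n).
Proof.
move=> ab; elim: n => [|n IHn]; first by rewrite !expr0 dle_refl.
by rewrite !exprS dleM.
Qed.
Lemma dltX a b n : (0 < n)%N -> dlt a b -> dlt (a ^+ n) (b ^+ n).
Proof.
case: n => // n _ ab; rewrite !exprS; apply: dltM => //.
  by rewrite expf_neq0 // (dlt_neq0 ab).
by apply: dleX; apply: dltW.
Qed.
Lemma dle_divr a b c : c != 0 -> dle a (b / c) = dle (c * a) b.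
Proof. by move=> c0; rewrite -(dleMK a _ c0) mulrCA divff // mulr1. Qed.
Lemma dlt_divr a b c : c != 0 -> dlt a (b / c) = dlt (c * a) b.
Proof. by move=> c0; rewrite -(dltMK a _ c0) mulrCA divff // mulr1. Qed.

Lemma valfX a g n : v a = Some g -> v (a ^+ n) = Some (g *+ n).
Proof.
move=> va; elim: n => [|n IHn]; first by rewrite expr0 valf1 mulr0n.
by rewrite exprS valfM va IHn /= mulrS.
Qed.

Lemma valf_eqX a b n : v a = v b -> v (a ^+ n) = v (b ^+ n).
Proof.
move=> ab; elim: n => [|n IHn]; first by rewrite !expr0.
by rewrite !exprS !valfM ab IHn.
Qed.

Lemma valf_eqV a b : v a = v b -> v a^-1 = v b^-1.
Proof.
have [->|a0] := eqVneq a 0.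
  by rewrite valf0 => /esym/valf_eq_oo ->.
move=> ab; have b0 : b != 0.
  by apply: contraNneq a0 => b0; apply/eqP/(valf_eq_oo v); rewrite ab b0 valf0.
have h u : v (a^-1 * (a * u)) = v (b^-1 * (b * u)) by rewrite !mulKf.
apply: vle_anti; rewrite -/(val_le _ _).
  rewrite -(dleMK _ _ a0) divff //.
  by have := vle_refl (v (b * b^-1)); rewrite {2}valfM -ab -valfM divff.
rewrite -(dleMK _ _ b0) divff //.
by have := vle_refl (v (a * a^-1)); rewrite {2}valfM ab -valfM divff.
Qed.

End ValuationTheory.

(** * Subfields given as sets, and algebraic elements over them *)

(* The proof [hE] is an argument so that the closure instances can be keyed on [sfpred]. *)
Definition sfpred (Om : fieldType) (E : set Om) (hE : subfield E) : {pred Om} :=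
  mem E.

HB.instance Definition _ (Om : fieldType) (E : set Om) (hE : subfield E) :=
  GRing.isDivringClosed.Build Om (sfpred hE) hE.

(** The subfield as a field type of its own: library results on field embeddings, such as those on
    algebraic elements and gcds, then apply to [sfval]. *)
Record subfield_type (Om : fieldType) (E : set Om) (hE : subfield E) :=
  SubfieldElt { sfval : Om; _ : sfval \in sfpred hE }.

HB.instance Definition _ Om E hE := [isSub of @subfield_type Om E hE for @sfval Om E hE].
HB.instance Definition _ Om E hE := [Choice of @subfield_type Om E hE by <:].
HB.instance Definition _ Om E hE :=
  [SubChoice_isSubIntegralDomain of @subfield_type Om E hE by <:].
HB.instance Definition _ Om E hE :=
  [SubIntegralDomain_isSubField of @subfield_type Om E hE by <:].

HB.instance Definition _ (Om : fieldType) (E : set Om) (hE : subfield E) :=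
  GRing.RMorphism.copy (@sfval Om E hE) (val : subfield_type hE -> Om).

Definition coefs_in (Om : fieldType) (E : set Om) (p : {poly Om}) := forall i, E p`_i.

Section SubfieldTheory.
Variables (Om : fieldType) (E : set Om) (hE : subfield E).
Implicit Types (a b : Om) (p q : {poly Om}).

Lemma sf_in a : (a \in sfpred hE) = (a \in E).
Proof. by []. Qed.

Lemma sfP a : E a <-> a \in sfpred hE.
Proof. by rewrite sf_in inE. Qed.

Lemma sf0 : E 0. Proof. by apply/sfP; rewrite rpred0. Qed.
Lemma sf1 : E 1. Proof. by apply/sfP; rewrite rpred1. Qed.
Lemma sfD a b : E a -> E b -> E (a + b).
Proof. by move=> /sfP ? /sfP ?; apply/sfP; rewrite rpredD. Qed.
Lemma sfN a : E a -> E (- a).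
Proof. by move=> /sfP ?; apply/sfP; rewrite rpredN. Qed.
Lemma sfB a b : E a -> E b -> E (a - b).
Proof. by move=> ? ?; apply/sfD/sfN. Qed.
Lemma sfM a b : E a -> E b -> E (a * b).
Proof. by move=> /sfP ? /sfP ?; apply/sfP; rewrite rpredM. Qed.
Lemma sfV a : E a -> E a^-1.
Proof. by move=> /sfP ?; apply/sfP; rewrite rpredV. Qed.
Lemma sf_div a b : E a -> E b -> E (a / b).
Proof. by move=> ? ?; apply/sfM/sfV. Qed.
Lemma sfX a n : E a -> E (a ^+ n).
Proof. by move=> /sfP ?; apply/sfP; rewrite rpredX. Qed.
Lemma sf_nat n : E n%:R.
Proof. by apply/sfP; rewrite rpred_nat. Qed.

Lemma coefs_inP p : coefs_in E p <-> p \is a polyOver (sfpred hE).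
Proof.
split=> [h|/polyOverP h i]; last exact/sfP.
by apply/polyOverP => i; apply/sfP.
Qed.

Lemma polyOver_coefs_in p : (p \is a polyOver (mem E)) <-> coefs_in E p.
Proof. by rewrite coefs_inP. Qed.

Lemma coefs_inD p q : coefs_in E p -> coefs_in E q -> coefs_in E (p + q).
Proof. by move=> /coefs_inP ? /coefs_inP ?; apply/coefs_inP; rewrite rpredD. Qed.
Lemma coefs_inB p q : coefs_in E p -> coefs_in E q -> coefs_in E (p - q).
Proof. by move=> /coefs_inP ? /coefs_inP ?; apply/coefs_inP; rewrite rpredB. Qed.
Lemma coefs_inM p q : coefs_in E p -> coefs_in E q -> coefs_in E (p * q).
Proof. by move=> /coefs_inP ? /coefs_inP ?; apply/coefs_inP; rewrite rpredM. Qed.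
Lemma coefs_inC a : E a -> coefs_in E a%:P.
Proof. by move=> /sfP h; apply/coefs_inP; rewrite polyOverC. Qed.
Lemma coefs_inZ a p : E a -> coefs_in E p -> coefs_in E (a *: p).
Proof. by move=> /sfP ? /coefs_inP ?; apply/coefs_inP; rewrite polyOverZ. Qed.
Lemma coefs_inX : coefs_in E 'X.
Proof. by apply/coefs_inP; rewrite polyOverX. Qed.
Lemma coefs_inXn n : coefs_in E 'X^n.
Proof. by apply/coefs_inP; rewrite rpredX // polyOverX. Qed.
Lemma coefs_in_deriv p : coefs_in E p -> coefs_in E p^`().
Proof. by move=> /coefs_inP ?; apply/coefs_inP; rewrite polyOver_deriv. Qed.
Lemma coefs_in_comp p q : coefs_in E p -> coefs_in E q -> coefs_in E (p \Po q).
Proof. by move=> /coefs_inP ? /coefs_inP ?; apply/coefs_inP; rewrite polyOver_comp. Qed.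
Lemma coefs_in_horner p a : coefs_in E p -> E a -> E p.[a].
Proof. by move=> /coefs_inP ? /sfP ?; apply/sfP; rewrite rpred_horner. Qed.

Notation iota := (@sfval Om E hE).

Lemma coefs_in_map p : coefs_in E p -> exists q : {poly subfield_type hE}, p = map_poly iota q.
Proof.
elim/poly_ind: p => [|p c IHp] h; first by exists 0; rewrite rmorph0.
have [|q ->] := IHp; first by move=> i; have := h i.+1; rewrite coefD coefMX coefC /= addr0.
have /sfP hc : E c by have := h 0%N; rewrite coefD coefMX coefC /= add0r.
exists (q * 'X + (SubfieldElt hc)%:P).
by rewrite rmorphD rmorphM /= map_polyX map_polyC.
Qed.

Lemma map_coefs_in (q : {poly subfield_type hE}) : coefs_in E (map_poly iota q).
Proof. by move=> i; rewrite coef_map; apply/sfP/valP. Qed.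

Lemma algebraic_overP a : algebraic_over E a <-> algebraicOver iota a.
Proof.
split=> [[p [/polyOver_coefs_in/coefs_in_map [q ->] q0 r]]|[q q0 r]].
  by exists q => //; apply: contraNneq q0 => ->; rewrite rmorph0.
exists (map_poly iota q); split=> //; first exact/polyOver_coefs_in/map_coefs_in.
by rewrite map_poly_eq0.
Qed.

Lemma subfield_algebraic : subfield (algebraic_over E).
Proof.
split=> [|a b|a b]; rewrite !inE.
- by apply/algebraic_overP; apply: algebraic1.
- by move=> /algebraic_overP ? /algebraic_overP ?; apply/algebraic_overP/algebraic_sub.
- by move=> /algebraic_overP ? /algebraic_overP ?; apply/algebraic_overP/algebraic_div.
Qed.

Lemma sub_algebraic : E `<=` algebraic_over E.
Proof.
move=> a /sfP ha; apply/algebraic_overP.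
exact: (algebraic_id iota (SubfieldElt ha)).
Qed.

(** Over a field, algebraic means integral, and a root of a polynomial with integral coefficients is
    integral. *)
Lemma algebraic_trans p a : coefs_in (algebraic_over E) p -> p != 0 -> root p a ->
  algebraic_over E a.
Proof.
move=> hp p0 ra; apply/algebraic_overP/integral_algebraic.
apply: (integral_root p0 ra) => _ /(nthP 0) [i _ <-].
exact/integral_algebraic/algebraic_overP.
Qed.

End SubfieldTheory.

(** * Simple field extensions *)

Section Adjoin.
Variable Om : fieldType.
Implicit Types (E L A : set Om).

Lemma subfield_smallest (C : set Om -> Prop) A :
  (forall L, C L -> subfield L) -> subfield (smallest C A).
Proof.
move=> hC; split=> [|a b|a b]; rewrite !inE.
- by move=> L [CL _]; apply: sf1; apply: hC.
- by move=> ha hb L CL; apply: sfB; [apply: hC CL.1 | apply: ha | apply: hb].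
- by move=> ha hb L CL; apply: sf_div; [apply: hC CL.1 | apply: ha | apply: hb].
Qed.

Lemma subfield_adjoin E A : subfield (adjoin E A).
Proof. exact: subfield_smallest. Qed.

Lemma sub_adjoinl E A : E `<=` adjoin E A.
Proof. by move=> a Ea L [_]; apply; left. Qed.

Lemma mem_adjoin1 E x : adjoin E [set x] x.
Proof. by move=> L [_]; apply; right. Qed.

Lemma adjoin1_sub E L x : subfield L -> E `<=` L -> L x -> adjoin E [set x] `<=` L.
Proof. by move=> hL EL Lx; apply: smallest_sub => // a [/EL //|/= ->]. Qed.

(** The fractions [p(x) / q(x)] form a subfield that contains [E] and [x]. *)
Lemma adjoin1_frac E x a : subfield E -> adjoin E [set x] a ->
  exists p q, [/\ coefs_in E p, coefs_in E q, q.[x] != 0 & a = p.[x] / q.[x]].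
Proof.
move=> hE; apply: (@smallest_sub _ _ _ [set a | exists p q,
  [/\ coefs_in E p, coefs_in E q, q.[x] != 0 & a = p.[x] / q.[x]]]).
  split=> [|b c|b c]; rewrite !inE /=.
  - exists 1, 1; rewrite hornerE oner_neq0 divr1; split=> //.
      exact: (coefs_inC hE (sf1 hE)).
    exact: (coefs_inC hE (sf1 hE)).
  - move=> [p [q [hp hq q0 ->]]] [p' [q' [hp' hq' q0' ->]]].
    exists (p * q' - p' * q), (q * q'); rewrite !hornerE mulf_neq0 //; split=> //.
    + by apply: coefs_inB => //; apply: coefs_inM.
    + exact: coefs_inM.
    + by field; rewrite q0 q0'.
  - move=> [p [q [hp hq q0 ->]]] [p' [q' [hp' hq' q0' ->]]].
    (* Division by zero yields 0, which is represented by [0 / 1]. *)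
    have [p0|p0] := eqVneq p'.[x] 0.
      exists 0, 1; rewrite !hornerE p0 oner_neq0 mul0r invr0 mulr0; split=> //.
        exact: (coefs_inC hE (sf0 hE)).
      exact: (coefs_inC hE (sf1 hE)).
    exists (p * q'), (q * p'); rewrite !hornerE mulf_neq0 //; split=> //.
    + exact: coefs_inM.
    + exact: coefs_inM.
    + by field; rewrite q0 p0 q0'.
move=> b [Eb|/= ->].
  exists b%:P, 1; rewrite !hornerE oner_neq0 divr1; split=> //.
    exact: (coefs_inC hE Eb).
  exact: (coefs_inC hE (sf1 hE)).
exists 'X, 1; rewrite !hornerE oner_neq0 divr1; split=> //.
  exact: coefs_inX.
exact: (coefs_inC hE (sf1 hE)).
Qed.

End Adjoin.

(** * Integral elements and linear factors *)

Definition vint (Om : fieldType) (G : orderedGroupType) (v : valuation Om G) :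
  {pred Om} := fun a => val_le v 1 a.

Lemma vint_subring (Om : fieldType) (G : orderedGroupType) (v : valuation Om G) :
  GRing.subring_closed (vint v).
Proof.
split=> [|a b|a b]; rewrite /in_mem /=.
- exact: dle_refl.
- exact: dleB.
- exact: dle1M.
Qed.

HB.instance Definition _ (Om : fieldType) (G : orderedGroupType)
    (v : valuation Om G) :=
  GRing.isSubringClosed.Build Om (vint v) (vint_subring v).

Section Roots.
Variable Om : fieldType.

Lemma closed_poly_split (p : {poly Om}) : GRing.closed_field_axiom Om ->
  exists rs, p = lead_coef p *: \prod_(a <- rs) ('X - a%:P).
Proof.
move=> hcl; have [n] := ubnP (size p); elim: n p => // n IHn p pn.
have [p1|p1] := leqP (size p) 1.
  exists [::]; rewrite big_nil; have := size1_polyC p1; move=> {1 2}->.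
  by rewrite lead_coefC alg_polyC.
have p0 : p != 0 by rewrite -size_poly_gt0 (ltn_trans _ p1).
have [a ra] : exists a, root p a.
  (* The axiom solves monic equations [a ^+ n = \sum_i P i * a ^+ i], so [p] is divided by its
     leading coefficient. *)
  have lp : lead_coef p != 0 by rewrite lead_coef_eq0.
  have s1 : (0 < (size p).-1)%N by rewrite -subn1 subn_gt0.
  have [a ea] := hcl _ (fun i => - (p`_i / lead_coef p)) s1.
  exists a; apply/eqP; rewrite horner_coef -(prednK (ltnW p1)) big_ord_recr /=.
  rewrite ea -/(lead_coef p) mulr_sumr -big_split /= big1 // => i _.
  by rewrite mulrA mulrN mulrCA divff // mulr1 mulNr addrN.
have /factor_theorem [q eq] := ra.
have q0 : q != 0 by apply: contraNneq p0 => q0; rewrite eq q0 mul0r.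
have [|rs ers] := IHn q.
  by move: pn; rewrite eq size_Mmonic ?monicXsubC // size_XsubC addn2 ltnS.
exists (a :: rs); rewrite big_cons eq lead_coef_Mmonic ?monicXsubC //.
by rewrite {1}ers -scalerAl [_ * ('X - _)]mulrC.
Qed.

Lemma root_split (c : Om) rs a : c != 0 ->
  root (c *: \prod_(b <- rs) ('X - b%:P)) a = (a \in rs).
Proof. by move=> c0; rewrite rootZ // root_prod_XsubC. Qed.

End Roots.

(** * Hensel's Lemma and henselizations *)

Section Hensel.
Variables (Om : fieldType) (G : orderedGroupType) (v : valuation Om G).
Implicit Types (a b c : Om) (p q f g : {poly Om}) (E L : set Om).
Local Notation dle := (val_le v).
Local Notation dlt := (val_lt v).

Lemma intpP p : reflect (forall i, dle 1 p`_i) (p \is a polyOver (vint v)).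
Proof. exact: (@polyOverP _ (vint v) p). Qed.

Lemma int_horner p a : p \is a polyOver (vint v) -> dle 1 a -> dle 1 p.[a].
Proof. by move=> ip ia; apply: (rpred_horner ip). Qed.

(** Division by the monic [X - b] following Horner's scheme never leaves the valuation ring. *)
Lemma int_factor p b : p \is a polyOver (vint v) -> dle 1 b ->
  exists2 g, g \is a polyOver (vint v) & p = p.[b]%:P + ('X - b%:P) * g.
Proof.
move=> /polyOverP ip ib; elim/poly_ind: p ip => [|p c IHp] ip.
  by exists 0; rewrite ?rpred0 // horner0 mulr0 addr0.
have [|g ig eg] := IHp; first by move=> i; have := ip i.+1; rewrite coefD coefMX coefC /= addr0.
have pg : p.[b]%:P + 'X * g \is a polyOver (vint v).
  apply: rpredD; last by apply: rpredM => //; apply: polyOverX.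
  rewrite polyOverC; apply: rpred_horner => //; apply/polyOverP => i.
  by have := ip i.+1; rewrite coefD coefMX coefC /= addr0.
exists (p.[b]%:P + 'X * g) => //.
by rewrite {1}eg hornerMXaddC polyCD polyCM; ring.
Qed.

Lemma int_horner_sub p a b : p \is a polyOver (vint v) -> dle 1 a -> dle 1 b ->
  dle (a - b) (p.[a] - p.[b]).
Proof.
move=> ip ia ib; have [g ig eg] := int_factor ip ib.
rewrite {1}eg !hornerE addrAC subrr add0r; apply: dle_mulr.
exact: int_horner.
Qed.

Lemma dlt1_int a b : dle 1 a -> dlt 1 (b - a) -> dle 1 b.
Proof. by move=> ia /dltW h; have := dleD h ia; rewrite subrK. Qed.

Lemma unit_near a b : v a = v 1 -> dlt 1 (b - a) -> v b = v 1.
Proof. by move=> va h; rewrite -(subrK a b) valfDr // /val_lt va. Qed.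

Lemma vunit_neq0 a : v a = v 1 -> a != 0.
Proof. by move=> h; rewrite -(dlt0 v) /val_lt h -/(val_lt _ _ _) dlt0 oner_neq0. Qed.

(* With [f = f(b) + (X - b) g], simplicity of the residual root says that [g] is a unit near it. *)
Lemma hensel_unit f g a b : f \is a polyOver (vint v) -> dle 1 a ->
  g \is a polyOver (vint v) -> f = f.[b]%:P + ('X - b%:P) * g ->
  v f^`().[a] = v 1 -> dlt 1 (b - a) -> dle (b - a) (g.[a] - f^`().[a]) /\
  forall c, dlt 1 (c - a) -> v g.[c] = v 1.
Proof.
move=> intf ia ig ef fa ba.
have h : dle (b - a) (g.[a] - f^`().[a]).
  rewrite ef !derivE !hornerE /= opprD addrA subrr add0r -mulNr opprB.
  by apply: dle_mulr; apply: int_horner => //; apply: polyOver_deriv.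
split=> // c ca; apply: unit_near (fa) _.
rewrite -(subrK g.[a] g.[c]) -addrA; apply: dltD; last exact: dlt_le_trans ba h.
by apply: (dlt_le_trans ca); apply: int_horner_sub; rewrite ?(dlt1_int ia ca).
Qed.

(** Here [f = (X - b) g] with [g(c)] a unit, so [f(c) = 0] forces [c = b]. *)
Lemma hensel_uniq f a b c : f \is a polyOver (vint v) -> dle 1 a ->
  v f^`().[a] = v 1 -> root f b -> root f c -> dlt 1 (b - a) -> dlt 1 (c - a) ->
  b = c.
Proof.
move=> intf ia fa /eqP rb /eqP rc ba ca.
have [g ig eg] := int_factor intf (dlt1_int ia ba).
have [_ /(_ c ca) ug] := hensel_unit intf ia ig eg fa ba.
move: rc; rewrite {1}eg rb !hornerE => /eqP; rewrite mulf_eq0.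
by rewrite (negPf (vunit_neq0 ug)) orbF subr_eq0 => /eqP.
Qed.

(** The logarithmic derivative at [a] is the sum of the [1 / (a - b)], all of which are integral. *)
Lemma prod_deriv_dle rs a : (forall b, b \in rs -> dle (a - b) 1) ->
  dle (\prod_(b <- rs) ('X - b%:P)).[a] (\prod_(b <- rs) ('X - b%:P))^`().[a].
Proof.
elim: rs => [|b rs IHrs] h; first by rewrite big_nil derivC !hornerE dle0.
rewrite big_cons derivM !hornerE derivXsubC !hornerE.
apply: dleD.
  have := dleM (h b (mem_head _ _)) (dle_refl v (\prod_(b <- rs) ('X - b%:P)).[a]).
  by rewrite mul1r.
by apply: dleM2l; apply: IHrs => c hc; apply: h; rewrite in_cons hc orbT.
Qed.

(** If every root had [v (b - a) <= 0], then [f'(a) / f(a)] would be integral, contrary to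
    [v (f(a)) > 0 = v (f'(a))]. *)
Lemma hensel_closed f a : GRing.closed_field_axiom Om ->
  dlt 1 f.[a] -> v f^`().[a] = v 1 -> exists2 b, root f b & dlt 1 (b - a).
Proof.
move=> hcl fa f'a; apply: contrapT => hn.
have [rs ers] := closed_poly_split f hcl.
have f0 : f != 0.
  apply/eqP => f0; have := vunit_neq0 f'a.
  by rewrite f0 derivC horner0 eqxx.
have : dle f.[a] f^`().[a].
  rewrite ers derivZ !hornerZ; apply: dleM2l; apply: prod_deriv_dle => b hb.
  rewrite dleNlt; apply/negP => h; apply: hn; exists b.
    by rewrite ers root_split // lead_coef_eq0.
  by rewrite /val_lt valfBC.
by move=> h; have := dlt_le_trans fa h; rewrite /val_lt f'a -/(val_lt _ _ _) dltxx.
Qed.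

Definition hensel_at L f a := [/\ coefs_in L f, f \is a polyOver (vint v), L a, dle 1 a &
  dlt 1 f.[a] /\ v f^`().[a] = v 1].

Lemma valuation_ringE L a : valuation_ring v L a <-> L a /\ dle 1 a.
Proof. by rewrite /valuation_ring /val_le valf1. Qed.

Lemma coefs_in_valuation_ring L f : subfield L ->
  f \is a polyOver (mem (valuation_ring v L)) <->
  coefs_in L f /\ f \is a polyOver (vint v).
Proof.
move=> hL; split.
  move=> /(all_nthP 0) h.
  have h' i : L f`_i /\ dle 1 f`_i.
    have [/h|/(nth_default 0) ->] := ltnP i (size f); last by split; [apply: sf0 | apply: dle0].
    by rewrite inE => /valuation_ringE.
  by split=> [i|]; [case: (h' i) | apply/intpP => i; case: (h' i)].
move=> [h1 /intpP h2]; apply/(all_nthP 0) => i _.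
by rewrite inE; apply/valuation_ringE.
Qed.

(** The root exists and is unique in [Om], so being henselian only asks that this root lie in
    [L]. *)
Lemma henselianP L : GRing.closed_field_axiom Om -> subfield L ->
  henselian v L <->
  forall f a b, hensel_at L f a -> root f b -> dlt 1 (b - a) -> L b.
Proof.
move=> hcl hL; split=> [h f a b [oL oi La ia [fa f'a]] rb ba|h f a].
  have [||||c [/valuation_ringE [Lc _] rc]] := h f a.
  - exact/coefs_in_valuation_ring.
  - exact/valuation_ringE.
  - by rewrite -(valf1 v).
  - by rewrite f'a valf1.
  rewrite -(valf1 v) => ca.
  by rewrite (hensel_uniq oi ia f'a rb rc ba ca).
move=> /(coefs_in_valuation_ring _ hL) [oL oi] /valuation_ringE [La ia].
rewrite -(valf1 v) => fa f'a; have [b rb ba] := hensel_closed hcl fa f'a.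
exists b; split=> //; apply/valuation_ringE; split; last exact: dlt1_int ba.
by apply: h rb ba; split.
Qed.

Section Henselization.
Hypothesis hcl : GRing.closed_field_axiom Om.

Lemma subfield_henselization E : subfield (henselization v E).
Proof. by apply: subfield_smallest => L []. Qed.

(** One and the same root in [Om] belongs to all the henselian fields that are intersected. *)
Lemma henselian_henselization E : henselian v (henselization v E).
Proof.
apply/(henselianP hcl (subfield_henselization E)).
move=> f a b [oL oi La ia [fa f'a]] rb ba L [[hL1 hL2] EL].
have [h _] := henselianP hcl hL1; apply: (h hL2 f a b) => //.
by split=> // [i|]; [apply: oL | apply: La].
Qed.

Lemma sub_henselization E : E `<=` henselization v E.
Proof. by move=> a Ea L [_]; apply. Qed.

Lemma henselization_sub E L : subfield L -> henselian v L -> E `<=` L ->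
  henselization v E `<=` L.
Proof. by move=> h1 h2; apply: smallest_sub. Qed.

Lemma henselization_mono E L : E `<=` henselization v L ->
  henselization v E `<=` henselization v L.
Proof.
by apply: henselization_sub; [apply: subfield_henselization | apply: henselian_henselization].
Qed.

(** The elements of [Om] algebraic over [E] form a henselian field. *)
Lemma henselization_algebraic E : subfield E ->
  henselization v E `<=` algebraic_over E.
Proof.
move=> hE; have hA := subfield_algebraic hE.
apply: henselization_sub (sub_algebraic hE) => //.
apply/(henselianP hcl hA) => f a b [oL _ _ _ [_ f'a]] rb _.
apply: (algebraic_trans hE oL _ rb).
by apply: contraTneq (vunit_neq0 f'a) => ->; rewrite derivC horner0 eqxx.
Qed.

End Henselization.

End Hensel.

(** * The closure of a subfield, and rank one *)

Section Closure.
Variables (Om : fieldType) (G : orderedGroupType) (v : valuation Om G).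
Implicit Types (a b c z w : Om) (p q f g : {poly Om}) (E L : set Om).
Local Notation dle := (val_le v).
Local Notation dlt := (val_lt v).

(** Topological closure in [Om]; the precision [b] runs over all of [Om], not only over [E]. *)
Definition vclosure E : set Om :=
  [set z | forall b, b != 0 -> exists2 e, E e & dle b (z - e)].

Definition archimedean_valuation : Prop :=
  forall a b, dlt 1 a -> b != 0 -> exists n, dle b (a ^+ n).

Lemma dle_upper b c : b != 0 -> c != 0 ->
  exists d, [/\ d != 0, dle b d & dle c d].
Proof.
move=> b0 c0; case/orP: (dle_total v b c) => h.
  by exists c; rewrite h dle_refl.
by exists b; rewrite h dle_refl.
Qed.

Lemma sub_vclosure E : E `<=` vclosure E.
Proof. by move=> a Ea b _; exists a => //; rewrite subrr dle0. Qed.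

Lemma vclosure_idem E : vclosure (vclosure E) `<=` vclosure E.
Proof.
move=> z hz b b0; have [w hw zw] := hz b b0; have [e Ee we] := hw b b0.
by exists e => //; have := dleD zw we; rewrite addrA subrK.
Qed.

Lemma vclosureD E z w : subfield E -> vclosure E z -> vclosure E w ->
  vclosure E (z - w).
Proof.
move=> hE hz hw b b0; have [e Ee ze] := hz b b0; have [f Ef wf] := hw b b0.
exists (e - f); first exact: sfB.
by have := dleB ze wf; congr (val_le _ _ _); ring.
Qed.

Lemma vclosureM E z w : subfield E -> vclosure E z -> vclosure E w ->
  vclosure E (z * w).
Proof.
move=> hE hz hw b b0.
have [->|w0] := eqVneq w 0.
  by exists 0; [exact: sf0 | rewrite mulr0 subr0 dle0].
(* Both summands of [z * w - e * f = (z - e) * w + e * (w - f)] are to have value at least [v b]; so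
   [z] is approximated up to [b / w] and then [w] up to [b / e]. *)
have [|e Ee ze] := hz (b / w); first by rewrite mulf_neq0 ?invr_eq0.
have h1 : dle b ((z - e) * w).
  by have := dleM2l w ze; rewrite mulrCA divff // mulr1 mulrC.
have [e0|e0] := eqVneq e 0.
  by exists 0; [exact: sf0 | move: h1; rewrite e0 !subr0].
have [|f Ef wf] := hw (b / e); first by rewrite mulf_neq0 ?invr_eq0.
have h2 : dle b (e * (w - f)).
  by have := dleM2l e wf; rewrite mulrCA divff // mulr1.
exists (e * f); first exact: sfM.
by have := dleD h1 h2; congr (val_le _ _ _); ring.
Qed.

Section Nontrivial.
Variable t : Om.
Hypotheses (t0 : t != 0) (t1 : dlt 1 t).

Lemma vclosureV E w : subfield E -> vclosure E w -> vclosure E w^-1.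
Proof.
move=> hE hw.
have [->|w0] := eqVneq w 0.
  by rewrite invr0; apply: sub_vclosure; exact: sf0.
move=> b b0.
have wt0 : w * t != 0 by rewrite mulf_neq0.
(* The bound [w * t] forces [v f = v w]; the bound [b * w^2] then controls
   [1/w - 1/f = (f - w) / (w * f)]. *)
have [c [c0 h1 h2]] := dle_upper wt0 (mulf_neq0 b0 (mulf_neq0 w0 w0)).
have [f Ef wf] := hw c c0.
have wwf : dlt w (w - f).
  by apply: (@dlt_le_trans _ _ _ (w * t)); [apply: dlt_mulr | apply: dle_trans h1 wf].
have vf : v f = v w.
  have := @valfDl _ _ v w (- (w - f)).
  by rewrite dltN opprB addrCA subrr addr0; apply.
have f0 : f != 0.
  by rewrite -(dlt0 v) /val_lt vf -/(val_lt _ _ _) dlt0.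
exists f^-1; first exact: sfV.
have -> : w^-1 - f^-1 = - (w - f) / (w * f) by field; rewrite w0 f0.
rewrite dle_divr ?mulf_neq0 // dleN; apply: dle_trans wf.
apply: dle_trans h2.
by rewrite /val_le !valfM vf -!valfM mulrC vle_refl.
Qed.

Lemma subfield_vclosure E : subfield E -> subfield (vclosure E).
Proof.
move=> hE; split=> [|a b|a b]; rewrite !inE.
- by apply: sub_vclosure; exact: sf1.
- exact: vclosureD.
- by move=> ha hb; apply: vclosureM => //; apply: vclosureV.
Qed.

(** The errors of successive approximations to the root [b] have values at least
    [(n + 1) v (b - a)], which are unbounded in the archimedean case; so [b] is a limit of elements
    of the closure. *)
Lemma henselian_vclosure E : GRing.closed_field_axiom Om ->
  archimedean_valuation -> subfield E -> henselian v (vclosure E).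
Proof.
move=> hcl harch hE; have hC := subfield_vclosure hE.
apply/(henselianP v hcl hC) => f a b [of_ intf Ca ia [fa f'a]] rb ba.
apply: vclosure_idem.
have [g ig eg] := int_factor intf (dlt1_int ia ba).
have [hg ug] := hensel_unit intf ia ig eg f'a ba.
have f'a0 : f^`().[a] != 0 := vunit_neq0 f'a.
(* Newton iteration with the constant slope [f'(a)] *)
have step n : exists2 c, vclosure E c & dle ((b - a) ^+ n.+1) (c - b) .
  elim: n => [|n [c Cc cb]]; first by exists a => //; rewrite expr1 /val_le valfBC vle_refl.
  have bac : dle (b - a) (c - b).
    apply: dle_trans cb; rewrite exprS; apply: dle_mulr.
    by apply: dle1X; apply: dltW.
  have ca : dle (b - a) (c - a).
    by rewrite -(subrK b c) -addrA; apply: dleD => //; apply: dle_refl.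
  have ic : dle 1 c.
    by apply: (dlt1_int ia); apply: dlt_le_trans ba ca.
  exists (c - f.[c] / f^`().[a]).
    apply: (sfB hC) => //; apply: (sf_div hC); apply: (coefs_in_horner hC) => //.
    exact: coefs_in_deriv.
  (* One step multiplies the error by [(f'(a) - g(c)) / f'(a)], whose value is at least
     [v (b - a)]. *)
  have -> : c - f.[c] / f^`().[a] - b = (c - b) * ((f^`().[a] - g.[c]) / f^`().[a]).
    have -> : f.[c] = (c - b) * g.[c].
      by rewrite {1}eg !hornerE (eqP rb) add0r.
    by field.
  rewrite exprSr; apply: dleM => //.
  rewrite dle_divr //.
  have : dle (b - a) (g.[c] - f^`().[a]).
    rewrite -(subrK g.[a] g.[c]) -addrA; apply: dleD => //.
    by apply: (dle_trans ca); apply: int_horner_sub.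
  by rewrite /val_le valfM f'a -valfM mul1r [v (_ - f^`().[_])]valfBC.
move=> c c0.
have [n hn] := harch _ _ ba c0.
have [e Ce eb] := step n; exists e => //.
rewrite /val_le valfBC -/(val_le _ _ _); apply: dle_trans eb; apply: (dle_trans hn).
by rewrite exprS mulrC; apply: dle_mulr; apply: dltW.
Qed.

Lemma henselization_vclosure E : GRing.closed_field_axiom Om ->
  archimedean_valuation -> subfield E -> henselization v E `<=` vclosure E.
Proof.
move=> hcl harch hE; apply: henselization_sub; last exact: sub_vclosure.
  exact: subfield_vclosure.
exact: henselian_vclosure.
Qed.

End Nontrivial.

(** The ultrametric inequality is an equality for distinct values, so the nonzero term of least
    value dominates. *)
Lemma val_sum_pairwise n (t : nat -> Om) :
  (forall i j, (i < j < n)%N -> t i != 0 -> t j != 0 -> v (t i) <> v (t j)) ->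
  (forall i, (i < n)%N -> t i = 0) \/
  exists i, [/\ (i < n)%N, t i != 0 & v (\sum_(j < n) t j) = v (t i)].
Proof.
elim: n => [|n IHn] h; first by left.
have [|t0|[i [ni ti vi]]] := IHn; first by move=> i j /andP [ij jn]; apply: h; rewrite ij (leqW jn).
  have s0 : \sum_(j < n) t j = 0 by apply: big1 => j _; apply: t0.
  have [tn|tn] := eqVneq (t n) 0.
    by left=> i; rewrite ltnS leq_eqVlt => /orP [/eqP ->|/t0].
  by right; exists n; rewrite ltnSn big_ord_recr /= s0 add0r.
right; have [tn|tn] := eqVneq (t n) 0.
  by exists i; rewrite (leqW ni) big_ord_recr /= tn addr0.
have hv := h i n (introT andP (conj ni (ltnSn n))) ti tn.
rewrite big_ord_recr /=.
case/boolP: (dlt (t i) (t n)) => [hi|].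
  by exists i; rewrite (leqW ni) valfDl // /val_lt vi.
rewrite -dleNlt => hle; exists n; rewrite ltnSn valfDr // /val_lt vi.
apply/negP => h'; apply: hv; exact: vle_anti.
Qed.

(** In the vanishing sum [p(a)] two nonzero terms must have equal value; comparing the terms of
    degrees [i < j] puts the value of [a ^+ (j - i)] into the value group of [F]. *)
Lemma algebraic_val_torsion F a : subfield F -> algebraic_over F a -> a != 0 ->
  exists n c, [/\ (0 < n)%N, F c, c != 0 & v (a ^+ n) = v c].
Proof.
move=> hF [p [/(polyOver_coefs_in hF) op p0 /eqP rp]] a0.
pose t i := p`_i * a ^+ i.
have [[i [j [/andP [ij jp] ti tj vij]]]|hn] := pselect (exists i j,
    [/\ (i < j < size p)%N, t i != 0, t j != 0 & v (t i) = v (t j)]).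
  have pi0 : p`_i != 0 by apply: contraNneq ti => e; rewrite /t e mul0r.
  have pj0 : p`_j != 0 by apply: contraNneq tj => e; rewrite /t e mul0r.
  exists (j - i)%N, (p`_i / p`_j); split.
  - by rewrite subn_gt0.
  - exact: sf_div.
  - by rewrite mulf_neq0 ?invr_eq0.
  have -> : p`_i / p`_j = t i * (a ^- i / p`_j).
    by rewrite /t; field; rewrite pj0 expf_neq0.
  have e : a ^+ j = a ^+ (j - i) * a ^+ i by rewrite -exprD subnK // ltnW.
  rewrite valfM vij -valfM /t e.
  by congr (v _); field; rewrite pj0 expf_neq0.
have [|t0|[i [ip ti vi]]] := @val_sum_pairwise (size p) t.
- by move=> i j ij ti tj vij; apply: hn; exists i, j.
- case/eqP: p0; apply/polyP => i; rewrite coef0.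
  have [/t0/eqP|/(nth_default 0) //] := ltnP i (size p).
  by rewrite mulf_eq0 expf_eq0 (negPf a0) andbF orbF => /eqP.
have := rp; rewrite horner_coef => s0; move: vi; rewrite s0 valf0 => /esym.
by move/valf_eq_oo/eqP; rewrite (negPf ti).
Qed.

(** Every value of [Om] has a positive multiple in [vF = vK], so the archimedean property passes
    from [vK] to [Om]. *)
Lemma rank_one_archimedean K F : subfield K -> subfield F -> rank_one v K ->
  value_group v F = value_group v K -> (forall a, algebraic_over F a) ->
  archimedean_valuation.
Proof.
move=> hK hF [_ harch] hval halg a b a1 b0.
have torsion c : c != 0 -> exists n k, [/\ (0 < n)%N, K k, k != 0 & v (c ^+ n) = v k].
  move=> c0; have [n [f [n0 Ff f0 vf]]] := algebraic_val_torsion hF (halg c) c0.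
  have [g vg] := valf_neq0 v f0.
  have : value_group v F g by exists f.
  rewrite hval => -[k Kk vk]; exists n, k; split=> //; last by rewrite vf vg vk.
  by apply/eqP => k0; move: vk; rewrite k0 valf0.
have [b1|b1] := boolP (dlt 1 b); last first.
  by exists 0%N; rewrite expr0 dleNlt.
have [a0|a0] := eqVneq a 0.
  by exists 1%N; rewrite a0 expr1 dle0.
have [n [k [n0 Kk k0 vk]]] := torsion a a0.
have [m [l [m0 Kl l0 vl]]] := torsion b b0.
have [g vg] := valf_neq0 v k0; have [h vh] := valf_neq0 v l0.
have gpos : 0 < g.
  have : dlt 1 (a ^+ n) by rewrite -(expr1n _ n); apply: dltX.
  rewrite /val_lt vk valf1 vg /vlt /= => h'; rewrite lt_neqAle.
  case/orP: (og_le_total g 0) => h''; first by rewrite h'' in h'.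
  by rewrite h'' andbT; apply: contraNneq h' => <-.
have [N hN] : exists N, h <= g *+ N by apply: harch => //; [exists k | exists l].
(* Here [n v(a) = v(k)] and [m v(b) = v(l) <= N v(k)], while [v(b) <= m v(b)]. *)
exists (n * N)%N; apply: (@dle_trans _ _ _ (b ^+ m)).
  by rewrite -(prednK m0) exprS; apply: dle_mulr; apply: dle1X; apply: dltW.
by rewrite /val_le vl vh exprM (valf_eqX N vk) (valfX N vg).
Qed.

End Closure.

(** * Polynomials without roots in a disc *)

Section Discs.
Variables (Om : fieldType) (G : orderedGroupType) (v : valuation Om G).
Implicit Types (a b c d s w z : Om) (p q f g m : {poly Om}) (E L : set Om).
Local Notation dle := (val_le v).
Local Notation dlt := (val_lt v).
Hypothesis hcl : GRing.closed_field_axiom Om.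

(** Polynomials over the maximal ideal, that is, those that vanish residually. *)
Definition nilcoefs p := forall i, dlt 1 p`_i.

Lemma nilcoefs0 : nilcoefs 0.
Proof. by move=> i; rewrite coef0 dlt0 oner_neq0. Qed.

Lemma nilcoefsD p q : nilcoefs p -> nilcoefs q -> nilcoefs (p + q).
Proof. by move=> hp hq i; rewrite coefD dltD. Qed.

Lemma nilcoefsXM p : nilcoefs p -> nilcoefs ('X * p).
Proof.
by move=> hp i; rewrite coefXM; case: ifP => // _; rewrite dlt0 oner_neq0.
Qed.

Lemma nilcoefs_int p : nilcoefs p -> p \is a polyOver (vint v).
Proof. by move=> hp; apply/intpP => i; apply: dltW. Qed.

Lemma nilcoefs_horner p a : nilcoefs p -> dle 1 a -> dlt 1 p.[a].
Proof.
move=> hp ia; rewrite horner_coef; elim/big_ind: _ => [||i _].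
- by rewrite dlt0 oner_neq0.
- by move=> ? ?; apply: dltD.
- by apply: dlt1M => //; apply: dle1X.
Qed.

(** A linear factor [X - a] becomes [(z - a) (1 + u X)] with [u = d / (z - a)] of positive value;
    such factors are multiplied up. *)
Lemma shift_factor p z d : (forall a, root p a -> dlt (z - a) d) ->
  exists2 m, nilcoefs m & p \Po (d *: 'X + z%:P) = p.[z] *: (1 + 'X * m).
Proof.
move=> hp; have p0 : p != 0.
  apply/eqP => p0; have := hp z; rewrite p0 root0 subrr => /(_ isT).
  by rewrite dltNle dle0.
have [rs ers] := closed_poly_split p hcl.
have {}hp a : a \in rs -> dlt (z - a) d.
  by move=> ha; apply: hp; rewrite ers root_split // lead_coef_eq0.
suff [m hm em] : exists2 m, nilcoefs m &
    (\prod_(a <- rs) ('X - a%:P)) \Po (d *: 'X + z%:P)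
    = (\prod_(a <- rs) ('X - a%:P)).[z] *: (1 + 'X * m).
  by exists m => //; rewrite {1}ers comp_polyZ em scalerA -hornerZ -ers.
elim: rs hp {ers} => [|a rs IHrs] hp.
  by exists 0; [exact: nilcoefs0 | rewrite big_nil comp_polyC hornerC mulr0 addr0 scale1r].
have [|m hm em] := IHrs; first by move=> b hb; apply: hp; rewrite in_cons hb orbT.
have za := hp a (mem_head _ _).
have za0 : z - a != 0 by apply: dlt_neq0 za.
have hu : dlt 1 (d / (z - a)) by rewrite dlt_divr // mulr1.
pose u := d / (z - a).
(* This is read off from [(1 + u X) (1 + X m) = 1 + X (m + u + X u m)]. *)
exists (m + u%:P + 'X * (u *: m)).
  apply: nilcoefsD; last first.
    by apply: nilcoefsXM => i; rewrite coefZ; apply: dlt1M => //; apply: dltW.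
  apply: nilcoefsD => // i; rewrite coefC; case: eqP => // _.
  by rewrite dlt0 oner_neq0.
rewrite big_cons comp_polyM em comp_polyB comp_polyX comp_polyC hornerM.
rewrite !hornerE -!mul_polyC.
have -> : d = (z - a) * u by rewrite /u mulrC divfK.
by rewrite !polyCM !polyCB; ring.
Qed.

Lemma shift_near p z d w : (forall a, root p a -> dlt (z - a) d) -> d != 0 ->
  dle d (w - z) -> exists2 e, dlt 1 e & p.[w] = p.[z] * (1 + (w - z) / d * e).
Proof.
move=> hp d0 wz; have [m hm em] := shift_factor hp.
have it : dle 1 ((w - z) / d) by rewrite dle_divr // mulr1.
exists m.[(w - z) / d]; first exact: nilcoefs_horner.
have := congr1 (horner^~ ((w - z) / d)) em.
have e : (d *: 'X + z%:P).[(w - z) / d] = w.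
  by rewrite hornerD hornerZ hornerX hornerC mulrC divfK // subrK.
by rewrite /= horner_comp e => ->; rewrite !hornerE.
Qed.

Lemma val_1D e : dlt 1 e -> v (1 + e) = v 1.
Proof. by move=> h; rewrite valfDl. Qed.

Lemma shift_val p z d w : (forall a, root p a -> dlt (z - a) d) -> d != 0 ->
  dle d (w - z) -> v p.[w] = v p.[z].
Proof.
move=> hp d0 wz; have [e he ->] := shift_near hp d0 wz.
rewrite -[in RHS](mulr1 p.[z]) !valfM val_1D // mulrC; apply: dlt1M => //.
by rewrite dle_divr // mulr1.
Qed.

(** The coefficients of [X] in [shift_factor] give [d p'(z) = p(z) m(0)] with [v (m(0)) > 0]. *)
Lemma shift_deriv p z d : (forall a, root p a -> dlt (z - a) d) ->
  dlt p.[z] (d * p^`().[z]).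
Proof.
move=> hp; have [m hm em] := shift_factor hp.
have pz : p.[z] != 0.
  apply/negP => /hp; rewrite subrr dltNle dle0 //.
have := congr1 (fun q => q`_1) em.
have -> : (p \Po (d *: 'X + z%:P))`_1 = d * p^`().[z].
  have := congr1 (horner^~ 0) (deriv_comp p (d *: 'X + z%:P)).
  rewrite horner_coef0 coef_deriv mulr1n => ->.
  by rewrite hornerM horner_comp !derivE !hornerE mulrC.
rewrite coefZ coefD coef1 coefXM /= add0r => ->.
by apply: dlt_mulr.
Qed.

(** Every point of the disc can serve as its centre. *)
Lemma near_roots p z w d : (forall a, root p a -> dlt (z - a) d) ->
  dle d (w - z) -> forall a, root p a -> dlt (w - a) d.
Proof.
move=> hp wz a /hp za.
by rewrite -(subrK z w) -addrA /val_lt valfDr //; apply: dlt_le_trans za wz.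
Qed.

(** Residually the bracket on the right is [X], so 0 is a simple residual root of it; Hensel's Lemma
    lifts it to a root [b] of positive value, and [w = d * b + a]. *)
Lemma hensel_disc L p a d u s m1 m2 : subfield L -> henselian v L -> coefs_in L p ->
  L a -> L d -> d != 0 -> u != 0 -> dlt 1 s -> nilcoefs m1 -> nilcoefs m2 ->
  p \Po (d *: 'X + a%:P) = u *: ('X * (1 + 'X * m1) + s *: (1 + 'X * m2)) ->
  exists2 w, L w & root p w /\ dlt d (w - a).
Proof.
move=> hL hH Lp La Ld d0 u0 s1 hm1 hm2 ep.
set g := 'X * (1 + 'X * m1) + s *: (1 + 'X * m2) in ep.
have ints : s \in vint v by apply: dltW.
have ig : g \is a polyOver (vint v).
  have [i1 i2] := (nilcoefs_int hm1, nilcoefs_int hm2).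
  by rewrite /g -mul_polyC rpredD ?rpredM ?rpredD ?rpredM ?rpred1 ?polyOverX ?polyOverC.
have g0 : g`_0 = s by rewrite /g !(coefD, coefXM, coefZ, coef1) /= add0r addr0 mulr1.
have g1 : v g`_1 = v 1.
  rewrite /g !(coefD, coefXM, coefZ, coef1) /= addr0 add0r.
  by apply: val_1D; apply: dlt1M => //; apply: dltW.
have g10 := vunit_neq0 g1.
have Lpg : coefs_in L (u *: g).
  rewrite -ep; apply: (coefs_in_comp hL) => //; apply: (coefs_inD hL); last exact: (coefs_inC hL).
  by apply: (coefs_inZ hL) => //; exact: (coefs_inX hL).
(* The scalar [u] need not lie in [L]; normalising the coefficient of [X] cancels it and gives a
   polynomial over [L]. *)
pose h := (g`_1)^-1 *: g.
have Lh : coefs_in L h.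
  have -> : h = ((u *: g)`_1)^-1 *: (u *: g).
    by rewrite scalerA coefZ invfM mulrAC mulVf // mul1r.
  by apply: (coefs_inZ hL) => //; apply: (sfV hL).
have ih : h \is a polyOver (vint v).
  rewrite polyOverZ //; rewrite /in_mem /= /vint /val_le (valf_eqV g1) invr1.
  exact: vle_refl.
have h0 : dlt 1 h.[0].
  rewrite horner_coef0 coefZ g0 mulrC; apply: dlt1M => //.
  by rewrite /val_le (valf_eqV g1) invr1 vle_refl.
have h1 : v h^`().[0] = v 1.
  by rewrite horner_coef0 coef_deriv mulr1n coefZ mulVf.
have [b rb hb] := hensel_closed hcl h0 h1.
have Lb : L b.
  apply: ((henselianP v hcl hL).1 hH h 0 b) => //; split=> //.
    exact: sf0.
  exact: dle0.
rewrite subr0 in hb.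
exists (d * b + a); first by apply: (sfD hL) => //; apply: (sfM hL).
split; last by rewrite addrK; apply: dlt_mulr.
have : root (u *: g) b.
  move: rb; rewrite /h !rootZ // invr_eq0 //.
by rewrite -ep /root horner_comp !hornerE.
Qed.

Definition cofinal_val L := forall b, b != 0 -> exists2 e, L e & e != 0 /\ dlt b e.

Lemma cofinal_seq L (s : seq Om) : subfield L -> cofinal_val L -> 0 \notin s ->
  exists2 e, L e & e != 0 /\ forall b, b \in s -> dlt b e.
Proof.
move=> hL hc; elim: s => [|b s IHs].
  by exists 1; [exact: sf1 | rewrite oner_neq0].
rewrite in_cons negb_or eq_sym => /andP [b0 /IHs [e Le [e0 he]]].
have [f Lf [f0 hf]] := hc b b0.
case/orP: (dle_total v e f) => h.
  exists f => //; split=> // c; rewrite in_cons => /orP [/eqP -> //|/he hce].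
  exact: dlt_le_trans h.
exists e => //; split=> // c; rewrite in_cons => /orP [/eqP ->|/he //].
exact: dlt_le_trans h.
Qed.

(** This is Krasner's argument: on a disc around [w] without other roots of [p], centred at some [a]
    in [L], Hensel's Lemma yields a root of [p] in [L], which can only be [w]. *)
Lemma vclosure_simple_root L p w : subfield L -> henselian v L -> cofinal_val L ->
  coefs_in L p -> root p w -> p^`().[w] != 0 -> vclosure v L w -> L w.
Proof.
move=> hL hH hc Lp rw p'w hw.
have /factor_theorem [q eq] := rw.
have qw : q.[w] != 0.
  by move: p'w; rewrite eq derivM !hornerE derivXsubC !hornerE subrr mulr0 add0r.
have q0 : q != 0 by apply: contraNneq qw => ->; rewrite horner0.
have [rs ers] := closed_poly_split q hcl.
have hrs a : root q a = (a \in rs) by rewrite ers root_split // lead_coef_eq0.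
have [|e Le [e0 he]] := @cofinal_seq L [seq w - a | a <- rs] hL hc.
  apply/mapP => -[a]; rewrite -hrs => ra /esym/eqP; rewrite subr_eq0 => /eqP wa.
  by move: ra; rewrite -wa /root (negPf qw).
have hroot a : root q a -> dlt (w - a) e.
  by rewrite hrs => ha; apply: he; apply: map_f.
have [f _ [f0 ef]] := hc e e0.
have [a La wa] := hw f f0.
have ewa : dlt e (a - w).
  by rewrite /val_lt valfBC -/(val_lt _ _ _); apply: dlt_le_trans wa.
have [m hm em] := shift_factor (near_roots hroot (dltW ewa)).
have qa : q.[a] != 0.
  by apply/negP => /(near_roots hroot (dltW ewa)); rewrite subrr dltNle dle0.
(* With [p = (X - w) q] and [s = (a - w) / e], [p(e X + a) = e q(a) (X + s) (1 + X m)]. *)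
have [||z Lz [rz za]] := @hensel_disc L p a e (e * q.[a]) ((a - w) / e) m m
    hL hH Lp La Le e0 (mulf_neq0 e0 qa) _ hm hm.
- by rewrite dlt_divr // mulr1.
- rewrite eq comp_polyM em comp_polyB comp_polyX comp_polyC -!mul_polyC.
  have -> : a%:P = (e * ((a - w) / e))%:P + w%:P :> {poly Om}.
    by rewrite mulrC divfK // polyCB subrK.
  by rewrite !polyCM; ring.
have [->//|zw] := eqVneq w z.
have rqz : root q z.
  by move: rz; rewrite eq rootM root_XsubC eq_sym (negPf zw) orbF.
have := hroot z rqz; rewrite dltNle => /negP [].
rewrite -(subrK a w) -addrA; apply: dleD.
  by rewrite /val_le valfBC; apply: dltW.
by rewrite /val_le valfBC; apply: dltW.
Qed.

End Discs.

(** * Roots of degree p in characteristic p *)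

Section PurelyInseparable.
Variables (Om : fieldType) (p : nat).
Hypothesis pchar : p \in [pchar Om].
Implicit Types (a b : Om) (f g : {poly Om}) (L M N : set Om).

Lemma coef_XsubC_exp b k : (('X - b%:P) ^+ k.+1)`_k = - b *+ k.+1.
Proof.
elim: k => [|k IHk]; first by rewrite expr1 coefB coefX coefC /= sub0r.
rewrite exprS mulrBl coefB coefXM coefCM /= IHk.
have -> : (('X - b%:P) ^+ k.+1)`_k.+1 = 1.
  have /monicP := monic_exp k.+1 (monicXsubC b).
  by rewrite /lead_coef size_exp_XsubC.
by rewrite mulr1 -mulrSr.
Qed.

Lemma XsubC_expp b : ('X - b%:P) ^+ p = 'X^p - (b ^+ p)%:P.
Proof.
have pcharP := rmorph_pchar (@polyC Om) pchar.
rewrite -(pFrobenius_autE pcharP) pFrobenius_autB_comm; last exact: mulrC.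
by rewrite !pFrobenius_autE polyC_exp.
Qed.

(* The gcd of [f] and [X^p - b^p = (X - b)^p] is a power [(X - b)^k] with [0 < k < p], and its
   subleading coefficient is [- k b]. *)
Lemma pth_root_mem M f b : subfield M -> M (b ^+ p) -> coefs_in M f -> root f b ->
  ~~ (('X - b%:P) ^+ p %| f) -> M b.
Proof.
move=> hM Mbp Mf rf ndiv.
have p0 := prime_gt0 (pcharf_prime pchar).
have Mh : coefs_in M (('X - b%:P) ^+ p).
  by rewrite XsubC_expp; apply: (coefs_inB hM); [exact: (coefs_inXn hM) | exact: (coefs_inC hM)].
have [f0 ef] := coefs_in_map hM Mf; have [h0 eh] := coefs_in_map hM Mh.
have Mg : coefs_in M (gcdp f (('X - b%:P) ^+ p)).
  by rewrite ef eh -gcdp_map; exact: map_coefs_in.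
have gdiv := dvdp_gcdr f (('X - b%:P) ^+ p).
have rg : root (gcdp f (('X - b%:P) ^+ p)) b.
  by rewrite root_gcd rf rootE horner_exp hornerXsubC subrr expr0n eqn0Ngt p0 eqxx.
have gf := dvdp_gcdl f (('X - b%:P) ^+ p).
move: (gcdp _ _) Mg gdiv rg gf => g Mg /dvdp_exp_XsubCP [k kp eqg] rg gf.
have {}kp : (k < p)%N.
  rewrite ltn_neqAle kp andbT; apply: contra ndiv => /eqP <-.
  by rewrite -(eqp_dvdl _ eqg).
case: k kp eqg => [|k] kp.
  rewrite expr0 => eqg; move: rg; rewrite (eqp_root eqg) rootE hornerE.
  by rewrite oner_eq0.
move=> /eqpP [[c1 c2] /= /andP [c10 c20] eg].
have gE : g = (c2 / c1) *: ('X - b%:P) ^+ k.+1.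
  by rewrite [c2 / c1]mulrC -scalerA -eg scalerA mulVf // scale1r.
have hk := Mg k; have hk1 := Mg k.+1; move: hk hk1.
rewrite gE !coefZ coef_XsubC_exp.
have -> : (('X - b%:P) ^+ k.+1)`_k.+1 = 1.
  have /monicP := monic_exp k.+1 (monicXsubC b).
  by rewrite /lead_coef size_exp_XsubC.
rewrite mulr1; have c0 : c2 / c1 != 0 by rewrite mulf_neq0 ?invr_eq0.
move: (c2 / c1) c0 => c c0 h1 h2.
have k0 : k.+1%:R != 0 :> Om.
  by rewrite -(dvdn_pcharf pchar) gtnNdvd.
have -> : b = - (c * (- b *+ k.+1) / c) / k.+1%:R.
  by rewrite [c * _]mulrC mulfK // -mulNrn opprK -[b *+ _]mulr_natr mulfK.
by apply: (sf_div hM); [apply: (sfN hM); apply: (sf_div hM) | apply: (sf_nat hM)].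
Qed.

Lemma pth_root_mem_size M f b : subfield M -> M (b ^+ p) -> coefs_in M f ->
  root f b -> f != 0 -> (size f <= p)%N -> M b.
Proof.
move=> hM Mbp Mf rf f0 sf; apply: pth_root_mem Mf rf _ => //.
by apply/negP => /(dvdp_leq f0); rewrite size_exp_XsubC ltnNge sf.
Qed.

(** If [(X - b)^p] divided [f], then [b] would be a multiple root, because [p > 1]. *)
Lemma pth_root_mem_simple M f b : subfield M -> M (b ^+ p) -> coefs_in M f ->
  root f b -> f^`().[b] != 0 -> M b.
Proof.
move=> hM Mbp Mf rf f'b; apply: pth_root_mem Mf rf _ => //.
apply: contra f'b => /dvdpP [q ->].
have := prime_gt1 (pcharf_prime pchar); case: (p) => [|[|n]] // _.
have Y0 : ('X - b%:P).[b] = 0 by rewrite hornerXsubC subrr.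
move: ('X - b%:P) Y0 => Y Y0.
by rewrite !exprS !derivM !(hornerM, hornerD) Y0 !(mul0r, mulr0, addr0, add0r).
Qed.

Lemma subfield_pth_root N : subfield N -> subfield [set a | N (a ^+ p)].
Proof.
move=> hN; split=> [|a b|a b]; rewrite !inE /=.
- by rewrite expr1n; exact: sf1.
- move=> ha hb; rewrite -!(pFrobenius_autE pchar) rmorphB /= !pFrobenius_autE.
  exact: sfB.
- by rewrite expr_div_n; apply: sf_div.
Qed.

Lemma horner_Frobenius f b :
  (map_poly (pFrobenius_aut pchar) f).[b ^+ p] = f.[b] ^+ p.
Proof. by rewrite -!(pFrobenius_autE pchar) horner_map. Qed.

(** The ring [N[x]] is a field since [1 / g(x) = g(x)^(p-1) / g(x)^p], where [g(x)^p] lies in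
    [N]. *)
Lemma subfield_simple_pth N x : subfield N -> N (x ^+ p) ->
  subfield [set z | exists2 f, coefs_in N f & z = f.[x]].
Proof.
move=> hN Nxp; split=> [|a b|a b]; rewrite !inE /=.
- by exists 1; [exact: (coefs_inC hN (sf1 hN)) | rewrite hornerC].
- move=> [f hf ->] [g hg ->]; exists (f - g); first exact: coefs_inB.
  by rewrite hornerD hornerN.
move=> [f hf ->] [g hg ->].
have Ngp : N (g.[x] ^+ p).
  rewrite -horner_Frobenius; apply: (coefs_in_horner hN) => // i.
  by rewrite coef_map /= pFrobenius_autE; apply: sfX.
exists (f * g ^+ p.-1 * ((g.[x] ^+ p)^-1)%:P).
  apply: (coefs_inM hN); last by apply: (coefs_inC hN); apply: (sfV hN).
  apply: (coefs_inM hN) => //; elim: p.-1 => [|n IHn].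
    exact: (coefs_inC hN (sf1 hN)).
  by rewrite exprS; apply: (coefs_inM hN).
rewrite hornerM hornerC hornerM horner_exp.
have p0 := prime_gt0 (pcharf_prime pchar).
have [->|g0] := eqVneq g.[x] 0.
  have -> : 0 ^+ p = 0 :> Om by rewrite expr0n eqn0Ngt p0.
  by rewrite invr0 !mulr0.
by rewrite -{2}(prednK p0) exprS; field; rewrite g0 expf_neq0.
Qed.

(** Reduction modulo [X^p - x^p], one Horner step at a time. *)
Lemma reduce_simple_pth N x f : subfield N -> N (x ^+ p) -> coefs_in N f ->
  exists g, [/\ coefs_in N g, (size g <= p)%N & f.[x] = g.[x]].
Proof.
move=> hN Nxp; elim/poly_ind: f => [|f c IHf] hf.
  by exists 0; rewrite size_poly0.
have Nc : N c by have := hf 0%N; rewrite coefD coefMX coefC /= add0r.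
have [|g [hg sg eg]] := IHf.
  by move=> i; have := hf i.+1; rewrite coefD coefMX coefC /= addr0.
have p0 := prime_gt0 (pcharf_prime pchar).
(* The truncation drops only the term of degree [p]; its value at [x] has been added to the constant
   term. *)
exists (\poly_(i < p) (g * 'X + (c + g`_p.-1 * x ^+ p)%:P)`_i); split.
- move=> i; rewrite coef_poly; case: ifP => _; last exact: sf0.
  rewrite coefD coefMX coefC; apply: (sfD hN); case: ifP => _ //; try exact: sf0.
  by apply: (sfD hN) => //; apply: (sfM hN).
- exact: size_poly.
rewrite hornerMXaddC eg.
set h := g * 'X + _.
have -> : \poly_(i < p) h`_i = h - g`_p.-1 *: 'X^p.
  apply/polyP => i; rewrite coef_poly coefB coefZ coefXn.
  have [ip|] := ltnP i p; first by rewrite (ltn_eqF ip) mulr0 subr0.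
  rewrite leq_eqVlt => /orP [/eqP <-|pi].
    by rewrite eqxx mulr1 /h coefD coefMX coefC -(prednK p0) /= addr0 subrr.
  rewrite eq_sym (ltn_eqF pi) mulr0 subr0 /h coefD coefMX coefC.
  have i0 : (0 < i)%N by apply: leq_trans pi.
  rewrite -(prednK i0) /= addr0 nth_default //; apply: leq_trans sg _.
  by rewrite -ltnS prednK.
rewrite hornerD hornerN hornerZ hornerXn /h hornerMXaddC.
by rewrite -eg addrA addrK.
Qed.

Section Valued.
Variables (G : orderedGroupType) (v : valuation Om G).
Hypothesis hcl : GRing.closed_field_axiom Om.

(** Frobenius carries the Hensel data of [f] over [M] to data over [N], so [b ^+ p] lies in [N]; as
    [b] is a simple root of [f], it lies in [M]. *)
Lemma henselian_pth_root M N : subfield N -> henselian v N -> subfield M ->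
  N `<=` M -> (forall a, M a -> N (a ^+ p)) -> henselian v M.
Proof.
move=> hN hNH hM NM MN; apply/(henselianP v hcl hM).
move=> f a b [Mf intf Ma ia [fa f'a]] rb ba.
have ib := dlt1_int ia ba.
have p0 := prime_gt0 (pcharf_prime pchar).
pose F := map_poly (pFrobenius_aut pchar) f.
have Fi i : F`_i = f`_i ^+ p by rewrite coef_map /= pFrobenius_autE.
have Nbp : N (b ^+ p).
  apply: ((henselianP v hcl hN).1 hNH F (a ^+ p)).
  - split.
    + by move=> i; rewrite Fi; apply: MN.
    + by apply/intpP => i; rewrite Fi; apply: dle1X; apply/intpP.
    + exact: MN.
    + exact: dle1X.
    + rewrite horner_Frobenius deriv_map horner_Frobenius; split.
        by rewrite -(expr1n _ p); apply: dltX.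
      by rewrite (valf_eqX p f'a) expr1n.
  - by rewrite rootE horner_Frobenius (eqP rb) expr0n eqn0Ngt p0.
  - rewrite -!(pFrobenius_autE pchar) -rmorphB /= pFrobenius_autE -(expr1n _ p).
    exact: dltX.
have [g ig eg] := int_factor intf ib.
have [_ ug] := hensel_unit intf ia ig eg f'a ba.
apply: (pth_root_mem_simple hM (NM _ Nbp) Mf rb).
rewrite eg derivD derivC add0r derivM derivXsubC mul1r hornerD hornerM hornerXsubC.
by rewrite subrr mul0r addr0; apply: vunit_neq0 (ug b ba).
Qed.

End Valued.

End PurelyInseparable.

(** * Algebraic elements in the closure of a henselian field *)

Section SeparableClosure.
Variables (Om : fieldType) (G : orderedGroupType) (v : valuation Om G).
Hypothesis hcl : GRing.closed_field_axiom Om.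
Implicit Types (f : {poly Om}) (L : set Om).

(** The degree of [f] is positive and zero in [Om], so the characteristic is some [p > 0]; then [p]
    divides every exponent that occurs in [f]. *)
Lemma deriv0_comp_Xp f : f^`() = 0 -> (1 < size f)%N ->
  exists p g, [/\ p \in [pchar Om], f = g \Po 'X^p, (size g < size f)%N &
    forall i, g`_i = 0 \/ exists j, g`_i = f`_j].
Proof.
move=> f' sf.
have fn i : f`_i.+1 *+ i.+1 = 0 by rewrite -coef_deriv f' coef0.
have [p hp] : exists p, p \in [pchar Om].
  have n0 : (0 < (size f).-1)%N by rewrite -subn1 subn_gt0.
  have [|p hp] := @natf0_pchar Om _ n0; last by exists p.
  have := fn (size f).-2; rewrite prednK // -/(lead_coef f) -[lead_coef f *+ _]mulr_natr => /eqP.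
  rewrite mulf_eq0 lead_coef_eq0 => /orP [/eqP f0|/eqP //].
  by rewrite f0 size_poly0 in sf.
have p1 := prime_gt1 (pcharf_prime hp).
(* This bound makes the size drop and loses no coefficient: for [i >= (size f).-1 > 0],
   [i * p >= 2 * i >= size f]. *)
exists p, (\poly_(i < (size f).-1) f`_(i * p)); split=> //.
- apply/polyP => i; rewrite coef_comp_poly_Xn ?(ltnW p1) // coef_poly.
  have [/dvdnP [j ->]|ndvd] := boolP (p %| i)%N; last first.
    case: i ndvd => [|i ndvd]; first by rewrite dvdn0.
    have /eqP := fn i; rewrite -mulr_natr mulf_eq0 -(dvdn_pcharf hp) (negPf ndvd) orbF.
    by move/eqP.
  rewrite mulnK ?(ltnW p1) //; case: ltnP => // h; rewrite nth_default //.
  apply: (@leq_trans (j * 2)); last by rewrite leq_mul2l p1 orbT.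
  rewrite muln2 -addnn -(prednK (ltnW sf)) -add1n leq_add //.
  by apply: leq_trans h; rewrite -subn1 subn_gt0.
- apply: leq_ltn_trans (size_poly _ _) _.
  by rewrite ltn_predL (ltnW sf).
by move=> i; rewrite coef_poly; case: ifP => _; [right; exists (i * p)%N | left].
Qed.

(** Induction on the size of [f]: a simple root lies in [L]; a multiple root is also a root of [f']
    if [f' != 0]; and if [f' = 0], then [f = g(X^p)] and [w ^+ p] is a root of [g]. *)
Lemma vclosure_algebraic L w : subfield L -> henselian v L -> cofinal_val v L ->
  algebraic_over L w -> vclosure v L w ->
  L w \/ exists2 p, p \in [pchar Om] & exists m, L (w ^+ (p ^ m)).
Proof.
move=> hL hH hc [f [/(polyOver_coefs_in hL) hf f0 rf]].
have [t _ [t0 t1]] := hc 1 (oner_neq0 _).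
have hV := subfield_vclosure t0 t1 hL.
have [n] := ubnP (size f); elim: n f w hf f0 rf => // n IHn f w hf f0 rf fn hw.
have [f'w|f'w] := eqVneq f^`().[w] 0; last first.
  by left; apply: (vclosure_simple_root hcl hL hH hc hf rf f'w hw).
have [f'0|f'0] := eqVneq f^`() 0; last first.
  apply: (IHn f^`() w) => //; first exact: coefs_in_deriv.
    exact/eqP.
  by apply: leq_trans (lt_size_deriv f0) _.
have [p [g [hp efg sg cg]]] := deriv0_comp_Xp f'0 (root_size_gt1 f0 rf).
have [|||||h|[p' hp' [m h]]] := IHn g (w ^+ p).
- by move=> i; case: (cg i) => [->|[j ->]]; [exact: sf0 | exact: hf].
- by apply: contraNneq f0 => g0; rewrite efg g0 comp_poly0.
- by move: rf; rewrite efg /root horner_comp hornerXn.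
- exact: leq_trans sg fn.
- exact: (sfX hV).
- by right; exists p => //; exists 1%N; rewrite expn1.
right; exists p => //; exists m.+1; rewrite expnS exprM.
by move: hp'; rewrite (pcharf_eq hp) !inE => /eqP e; rewrite e in h.
Qed.

End SeparableClosure.

(** * Roots of polynomials near a transcendental approximation type *)

Section ApproximationType.
Variables (Om : fieldType) (G : orderedGroupType) (v : valuation Om G).
Variables (K : set Om) (x : Om).
Hypotheses (hcl : GRing.closed_field_axiom Om) (hK : subfield K).
Hypothesis hx : transcendental_appr v x K.
Implicit Types (a b c : Om) (f : {poly Om}).
Local Notation dle := (val_le v).
Local Notation dlt := (val_lt v).

(** A best approximation [c] would lie in all sets of the immediate approximation type. *)
Lemma appr_improve c : K c -> exists2 c', K c' & dlt (x - c) (x - c').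
Proof.
move=> Kc; apply: contrapT => hn.
suff : (\bigcap_(A in appr v x K) A) c by rewrite hx.1.
move=> A [[c' Ac'] [al _ eA]]; move: Ac'; rewrite eA => -[Kc' hc'].
split=> //; apply: vle_trans hc' _; rewrite -/(val_le _ _ _) dleNlt.
by apply/negP => h; apply: hn; exists c'.
Qed.

(** [P] holds for successively better approximations of [x] from [c0] onwards. *)
Definition appr_above c0 (P : Om -> Om -> Prop) := forall c1 c2, K c1 -> K c2 ->
  dle (x - c0) (x - c1) -> dlt (x - c1) (x - c2) -> P c1 c2.

Lemma appr_aboveI P Q : (exists2 c, K c & appr_above c P) ->
  (exists2 c, K c & appr_above c Q) ->
  exists2 c, K c & appr_above c (fun c1 c2 => P c1 c2 /\ Q c1 c2).
Proof.
move=> [c Kc hP] [d Kd hQ].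
case/orP: (dle_total v (x - c) (x - d)) => h.
  exists d => // c1 c2 K1 K2 h1 h2; split; last exact: hQ.
  by apply: hP => //; apply: dle_trans h1.
exists c => // c1 c2 K1 K2 h1 h2; split; first exact: hP.
by apply: hQ => //; apply: dle_trans h1.
Qed.

Lemma val_appr_far a c : dlt (x - c) (x - a) -> v (c - a) = v (x - c).
Proof.
move=> h; have -> : c - a = - (x - c) + (x - a) by ring.
by rewrite -[v (x - c)]valfN; apply: valfDl; rewrite /val_lt valfN.
Qed.

Lemma val_appr_near a c : dlt (x - a) (x - c) -> v (c - a) = v (x - a).
Proof.
move=> h; have -> : c - a = - (x - c) + (x - a) by ring.
by apply: valfDr; rewrite dltN.
Qed.

(** If [a] is closer to [x] than all of [K], then [v (c - a) = v (x - c)], which keeps increasing;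
    otherwise [v (c - a)] is eventually [v (x - a)]. *)
Lemma appr_linear a : exists2 c0, K c0 & appr_above c0 (fun c1 c2 =>
  [/\ c1 - a != 0, dle (c1 - a) (c2 - a) &
     (forall c, K c -> dlt (x - c) (x - a)) -> dlt (c1 - a) (c2 - a)]).
Proof.
have [hbad|hgood] := pselect (forall c, K c -> dlt (x - c) (x - a)).
  exists 0; first exact: sf0.
  move=> c1 c2 K1 K2 _ h12.
  have h : dlt (c1 - a) (c2 - a).
    by rewrite /val_lt (val_appr_far (hbad _ K1)) (val_appr_far (hbad _ K2)).
  by split=> //; [apply: dlt_neq0 h | apply: dltW].
have [c Kc hc] : exists2 c, K c & dle (x - a) (x - c).
  apply: contrapT => hn; apply: hgood => c Kc; rewrite dltNle; apply/negP => h.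
  by apply: hn; exists c.
have [c0 Kc0 h0] := appr_improve Kc; exists c0 => // c1 c2 K1 K2 h1 h12.
have ha1 : dlt (x - a) (x - c1) := dlt_le_trans (dle_lt_trans hc h0) h1.
have ha2 := dlt_trans ha1 h12.
split.
- rewrite subr_eq0; apply/eqP => e; move: ha1; rewrite e dltxx //.
- by rewrite /val_le (val_appr_near ha1) (val_appr_near ha2) vle_refl.
by move=> /(_ c Kc); rewrite dltNle hc.
Qed.

Lemma appr_prod rs : exists2 c0, K c0 & appr_above c0 (fun c1 c2 =>
  let q := \prod_(a <- rs) ('X - a%:P) in
  [/\ q.[c1] != 0, dle q.[c1] q.[c2] & forall a, a \in rs ->
     (forall c, K c -> dlt (x - c) (x - a)) -> dlt q.[c1] q.[c2]]).
Proof.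
elim: rs => [|b rs IHrs].
  exists 0; first exact: sf0.
  move=> c1 c2 _ _ _ _; rewrite /= big_nil !hornerE oner_neq0; split=> //.
  exact: dle_refl.
have [c0 Kc0 h] := appr_aboveI (appr_linear b) IHrs.
exists c0 => // c1 c2 K1 K2 h1 h12.
have [[n1 l1 s1] /= [n2 l2 s2]] := h c1 c2 K1 K2 h1 h12.
rewrite big_cons !hornerM !hornerXsubC; split.
- by rewrite mulf_neq0.
- exact: dleM.
move=> a; rewrite in_cons => /orP [/eqP ->|ha] hbad.
  by apply: dltM => //; apply: s1.
by rewrite ![(_ - b) * _]mulrC; apply: dltM => //; apply: s2 ha hbad.
Qed.

(* Along [c1, c2] approaching [x], a root [a] closer to [x] than all of [K] makes [v (f c)]
   strictly increase, whereas the value of [f] is fixed by the approximation type. *)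
Lemma appr_root_bound f a : coefs_in K f -> f != 0 -> root f a ->
  exists2 c, K c & dle (x - a) (x - c).
Proof.
move=> Kf f0 ra; apply: contrapT => hn.
have hbad c : K c -> dlt (x - c) (x - a).
  by move=> Kc; rewrite dltNle; apply/negP => h; apply: hn; exists c.
have [rs ers] := closed_poly_split f hcl.
have ars : a \in rs by rewrite -(root_split rs a (c := lead_coef f)) ?lead_coef_eq0 // -ers.
have [c0 Kc0 h0] := appr_prod rs.
have [al _ [g [_ [c3 [K3 g3]] hg]]] := hx.2 f ((polyOver_coefs_in hK f).2 Kf).
have [c1 K1 [h01 h31]] : exists2 c1, K c1 & dle (x - c0) (x - c1) /\ dle (x - c3) (x - c1).
  case/orP: (dle_total v (x - c0) (x - c3)) => h; [exists c3 | exists c0] => //.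
    by rewrite dle_refl.
  by rewrite dle_refl.
have [c2 K2 h12] := appr_improve K1.
have [_ _ /(_ a ars hbad)] := h0 c1 c2 K1 K2 h01 h12.
have lf0 : lead_coef f != 0 by rewrite lead_coef_eq0.
rewrite -(dltMK v _ _ lf0) -!hornerZ -ers /val_lt !hg ?/vlt ?vle_refl //.
  by split=> //; apply: vle_trans g3 _; apply: dle_trans h31 (dltW h12).
by split=> //; apply: vle_trans g3 _.
Qed.

End ApproximationType.

(** * Descent of [x] to a henselian field that contains [y] *)

Section Descent.
Variables (Om : fieldType) (G : orderedGroupType) (v : valuation Om G).
Variables (K : set Om) (x d : Om).
Hypotheses (hcl : GRing.closed_field_axiom Om) (hK : subfield K).
Hypotheses (d0 : d != 0) (Kd : K d).
Hypothesis far : forall f a, coefs_in K f -> f != 0 -> root f a -> val_lt v (x - a) d.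
Implicit Types (a b c w y : Om) (f : {poly Om}) (L : set Om).
Local Notation dle := (val_le v).
Local Notation dlt := (val_lt v).

Lemma vclosure_generator L y : subfield L -> henselian v L -> K `<=` L -> L y ->
  dlt d (x - y) -> vclosure v (adjoin K [set x]) y -> vclosure v L x.
Proof.
move=> hL hH KL Ly dxy hy b b0.
have [xy|xy] := eqVneq x y; first by exists y; rewrite // xy subrr dle0.
have xy0 : x - y != 0 by rewrite subr_eq0.
(* Precision [x - y] as well as [b] keeps [e] in the disc: [v (e - x) > v d]. *)
have [b' [b'0 bb' xyb']] := dle_upper v b0 xy0.
have [e /(adjoin1_frac hK) [A [B [KA KB Bx0 eE]]] ye] := hy b' b'0.
have hye := dle_trans bb' ye.
have dye : dlt d (y - e) by apply: dlt_le_trans dxy (dle_trans xyb' ye).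
have dex : dlt d (e - x).
  have -> : e - x = - (y - e) - (x - y) by ring.
  by apply: dltB => //; rewrite dltN.
pose C := A - 'X * B.
have KC : coefs_in K C.
  by apply: (coefs_inB hK) => //; apply: (coefs_inM hK) => //; exact: (coefs_inX hK).
have Cx : C.[x] = B.[x] * (e - x).
  by rewrite /C hornerD hornerN hornerM hornerX eE; field.
have [C0|C0] := eqVneq C 0.
  have ex : e = x.
    move/eqP: Cx; rewrite C0 horner0 eq_sym mulf_eq0 (negPf Bx0) subr_eq0.
    by move/eqP.
  by exists y => //; rewrite /val_le valfBC -{1}ex.
have B0 : B != 0 by apply: contraNneq Bx0 => ->; rewrite horner0.
have farB a : root B a -> dlt (x - a) d by apply: far.
have farC a : root C a -> dlt (x - a) d by apply: far.
have dyx : dle d (y - x) by rewrite /val_le valfBC; apply: dltW.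
have [mB hmB emB] := shift_factor hcl (near_roots farB dyx).
have [mC hmC emC] := shift_factor hcl (near_roots farC dyx).
have vB := shift_val hcl farB d0 dyx.
have vC := shift_val hcl farC d0 dyx.
have By0 : B.[y] != 0.
  by rewrite -(dlt0 v) /val_lt vB -/(val_lt _ _ _) dlt0.
(* The roots of [h] solve [r w = y] for [r = A / B]; as [h = (X - y) B + C], the substitution
   [d X + y] gives the form required by [hensel_disc]. *)
pose h := A - y *: B.
have Lh : coefs_in L h.
  apply: (coefs_inB hL); first by move=> i; apply: KL.
  by apply: (coefs_inZ hL) => // i; apply: KL.
have [||w Lw [rw wy]] := @hensel_disc _ _ v hcl L h y d (d * B.[y]) (C.[y] / (d * B.[y]))
    mB mC hL hH Lh Ly (KL _ Kd) d0 (mulf_neq0 d0 By0) _ hmB hmC.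
- rewrite dlt_divr ?mulf_neq0 // mulr1 /val_lt valfM vB vC -valfM Cx.
  by rewrite -/(val_lt _ _ _) mulrC dltMK.
- have -> : h = ('X - y%:P) * B + C by rewrite /h /C -mul_polyC; ring.
  rewrite comp_polyD comp_polyM emB emC comp_polyB comp_polyX comp_polyC.
  rewrite -!mul_polyC; set s := C.[y] / _.
  have -> : C.[y] = d * B.[y] * s by rewrite /s mulrC divfK ?mulf_neq0.
  by rewrite !polyCM; ring.
exists w => //.
have dwx : dlt d (w - x).
  have -> : w - x = (w - y) - (x - y) by ring.
  exact: dltB.
have [nu hnu eB] := shift_near hcl farB d0 (dltW dwx).
have [mu hmu eC] := shift_near hcl farC d0 (dltW dwx).
have [wx|wx] := eqVneq w x; first by rewrite wx subrr dle0.
pose t := (w - x) / d.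
have it : dlt 1 t by rewrite dlt_divr // mulr1.
have u0 : 1 + t * nu != 0.
  by apply: (@vunit_neq0 _ _ v); apply: val_1D; apply: dlt1M => //; apply: dltW.
have eA : A.[w] = y * B.[w].
  by move/eqP: rw; rewrite /h hornerD hornerN hornerZ => /eqP; rewrite subr_eq0 => /eqP.
(* [R = (r w - w) - (r x - x)]. Near constancy of [B] and [C] gives [v R > v (w - x)], so that
   [v (w - x) = v (y - e)]. *)
pose R := t * ((e - x) * ((mu - nu) / (1 + t * nu))).
have eR : w - x = (y - e) - R.
  have Bw0 : B.[w] != 0 by rewrite eB mulf_neq0.
  have : C.[w] = (y - w) * B.[w] by rewrite /C hornerD hornerN hornerM hornerX eA; ring.
  rewrite eC eB Cx -/t => /(congr1 (fun z => z / (B.[x] * (1 + t * nu)))) eq1.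
  have -> : y = w + (e - x) * (1 + t * mu) / (1 + t * nu).
    apply/eqP; rewrite addrC -subr_eq; apply/eqP.
    rewrite mulfK ?mulf_neq0 // in eq1; rewrite -eq1.
    by field; rewrite u0.
  by rewrite /R; field; rewrite u0.
have hR : dlt (w - x) R.
  have -> : R = (w - x) * ((e - x) / d * ((mu - nu) / (1 + t * nu))).
    by rewrite /R {1}/t; move: (_ / (1 + _)) => z; field.
  apply: dlt_mulr; first by rewrite subr_eq0.
  rewrite mulrC; apply: dlt1M; last by rewrite dle_divr // mulr1; apply: dltW.
  rewrite dlt_divr // mulr1.
  have : dlt 1 (mu - nu) by apply: dltB.
  by apply: vle_lt_trans; rewrite val_1D ?vle_refl //; apply: dlt1M => //; apply: dltW.
rewrite /val_le valfBC -/(val_le _ _ _) dleNlt; apply/negP => hb.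
have := dltB (dlt_le_trans hb hye) hR.
by rewrite -eR dltxx.
Qed.

(** Clearing denominators in an equation for [y] over [K(x)] gives a polynomial in [x] over [K[y]],
    nonzero because [y] is transcendental over [K]. *)
Lemma algebraic_exchange L y : subfield L -> K `<=` L -> L y ->
  algebraic_over (adjoin K [set x]) y ->
  (forall f, coefs_in K f -> f != 0 -> ~~ root f y) -> algebraic_over L x.
Proof.
move=> hL KL Ly [f [/(polyOver_coefs_in (subfield_adjoin _ _)) hf f0 rf]] ytr.
pose n := size f.
have /choice [AB hAB] i : exists AB : {poly Om} * {poly Om},
    [/\ coefs_in K AB.1, coefs_in K AB.2, AB.2.[x] != 0 & f`_i = AB.1.[x] / AB.2.[x]].
  by have [p [q h]] := adjoin1_frac hK (hf i); exists (p, q).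
pose D (i : 'I_n) := (AB i).1 * \prod_(j < n | j != i) (AB j).2.
have KD i : coefs_in K (D i).
  apply: (coefs_inM hK); first by case: (hAB i).
  elim/big_ind: _ => [|p q|j _]; first exact: (coefs_inC hK (sf1 hK)).
    exact: (coefs_inM hK).
  by case: (hAB j).
pose b := \prod_(j < n) (AB j).2.[x].
have b0 : b != 0 by apply/prodf_neq0 => j _; case: (hAB j).
have Dx i : (D i).[x] = f`_i * b.
  rewrite /D hornerM horner_prod /b [in RHS](bigD1 i) //=.
  by case: (hAB i) => _ _ q0 ->; rewrite mulrA divfK.
pose Q := \sum_(i < n) y ^+ i *: D i.
have LQ : coefs_in L Q.
  rewrite /Q; elim/big_ind: _ => [|p q|i _].
  - exact: (coefs_inC hL (sf0 hL)).
  - exact: (coefs_inD hL).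
  - by apply: (coefs_inZ hL); [exact: (sfX hL) | move=> j; apply: KL; apply: KD].
have rQ : root Q x.
  rewrite rootE horner_sum; apply/eqP.
  transitivity (f.[y] * b); last by rewrite (eqP rf) mul0r.
  rewrite horner_coef mulr_suml; apply: eq_bigr => i _.
  by rewrite hornerZ Dx mulrCA mulrA.
exists Q; split=> //; first exact/(polyOver_coefs_in hL).
have n0 : (n.-1 < n)%N by rewrite ltn_predL size_poly_gt0.
pose i := Ordinal n0.
have fi0 : f`_i != 0 by rewrite -[f`_i]/(lead_coef f) lead_coef_eq0.
have Di0 : D i != 0.
  apply/eqP => e; have := Dx i; rewrite e horner0 => /esym/eqP.
  by rewrite mulf_eq0 (negPf fi0) (negPf b0).
(* If [Q] vanished, its coefficients of degree [j] would give an equation [g(y) = 0] over [K]; this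
   [j] is the degree of the nonzero [D i], so [g != 0]. *)
pose j := (size (D i)).-1.
pose g := \poly_(k < n) (if insub k is Some k' then (D k')`_j else 0).
have gE (k : 'I_n) : g`_k = (D k)`_j by rewrite coef_poly ltn_ord valK.
have Kg : coefs_in K g.
  move=> k; rewrite coef_poly; case: ifP => _; last exact: sf0.
  by case: insub => [k'|]; [apply: KD | exact: sf0].
have g0 : g != 0.
  apply/eqP => e; have := gE i; rewrite e coef0 => /esym/eqP.
  by rewrite -/(lead_coef _) lead_coef_eq0 (negPf Di0).
have := ytr g Kg g0; apply: contraNneq => Q0.
have : Q`_j = 0 by rewrite Q0 coef0.
rewrite /Q coef_sum => e; rewrite rootE (@horner_coef_wide _ n) ?size_poly //.
apply/eqP; rewrite -[RHS]e; apply: eq_bigr => k _.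
by rewrite gE coefZ mulrC.
Qed.

Lemma far_transcendental y : dle d (x - y) ->
  forall f, coefs_in K f -> f != 0 -> ~~ root f y.
Proof.
move=> h f Kf f0; apply/negP => /(far Kf f0).
by rewrite dltNle h.
Qed.

Section Pchar.
Variable p : nat.
Hypothesis pchar : p \in [pchar Om].

(** As [C' = - B], [shift_deriv] gives [v (C(x)) < v (d B(x))], whereas [C(x) = B(x) (e - x)] with
    [v (e - x) >= v d]. *)
Lemma adjoin_pth_not_close y : dle d (x - y) ->
  ~ vclosure v (adjoin K [set x ^+ p]) y.
Proof.
move=> dxy /(_ d d0) [e /(adjoin1_frac hK) [A0 [B0 [KA0 KB0 B0x eE]]] dye].
pose A := A0 \Po 'X^p; pose B := B0 \Po 'X^p.
have KA : coefs_in K A by apply: (coefs_in_comp hK) => //; exact: (coefs_inXn hK).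
have KB : coefs_in K B by apply: (coefs_in_comp hK) => //; exact: (coefs_inXn hK).
have dX (f : {poly Om}) : (f \Po 'X^p)^`() = 0.
  by rewrite deriv_comp derivXn -mulr_natr -polyC1 -polyCMn pcharf0 // polyC0 !mulr0.
have Ax : A.[x] = A0.[x ^+ p] by rewrite horner_comp hornerXn.
have Bx : B.[x] = B0.[x ^+ p] by rewrite horner_comp hornerXn.
pose C := A - 'X * B.
have KC : coefs_in K C.
  by apply: (coefs_inB hK) => //; apply: (coefs_inM hK) => //; exact: (coefs_inX hK).
have Cx : C.[x] = B.[x] * (e - x).
  by rewrite /C hornerD hornerN hornerM hornerX eE Ax Bx; field.
have C' : C^`() = - B.
  by rewrite derivB derivM derivX !dX mul1r mulr0 addr0 sub0r.
have C0 : C != 0.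
  apply: contraNneq B0x => C0; have := C'; rewrite C0 derivC => /esym/eqP.
  by rewrite oppr_eq0 -Bx => /eqP ->; rewrite horner0.
have := shift_deriv hcl (fun a => far KC C0).
rewrite C' hornerN mulrN dltN Cx [d * _]mulrC dltMK ?Bx //.
rewrite dltNle => /negP [].
have -> : e - x = - (y - e) - (x - y) by ring.
by apply: dleB => //; rewrite dleN.
Qed.

Let H j := henselization v (adjoin K [set x ^+ (p ^ j)]).

Let subH j : subfield (H j).
Proof. exact: subfield_henselization. Qed.

Let KH j : K `<=` H j.
Proof. by move=> a Ka; apply: sub_henselization; apply: sub_adjoinl. Qed.

Let xH j : H j (x ^+ (p ^ j)).
Proof. by apply: sub_henselization; apply: mem_adjoin1. Qed.

(** The elements whose [p]-th power lies in [H j.+1] form a henselian field containing [K] and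
    [x ^+ (p ^ j)]. *)
Let pthH j : H j `<=` [set a | H j.+1 (a ^+ p)].
Proof.
have hM := subfield_pth_root pchar (subH j.+1).
apply: henselization_sub => //.
  apply: (henselian_pth_root pchar hcl (subH j.+1) _ hM) => [|a ha|//].
    exact: henselian_henselization.
  exact: (sfX (subH j.+1)).
apply: adjoin1_sub => // [a Ka|/=].
  by apply: (sfX (subH j.+1)); apply: KH.
by rewrite -exprM mulnC -expnS; exact: xH.
Qed.

(** The field [H 1 [x]] is henselian because its [p]-th powers lie in [H 1]; it contains [K] and
    [x]. *)
Let H0_simple : H 0 `<=` [set z | exists2 f, coefs_in (H 1) f & z = f.[x]].
Proof.
have xp : H 1 (x ^+ p) by have := @xH 1%N; rewrite expn1.
have hM := subfield_simple_pth pchar (subH 1%N) xp.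
have sub : H 1 `<=` [set z | exists2 f, coefs_in (H 1) f & z = f.[x]].
  by move=> a ha; exists a%:P; [exact: (coefs_inC (subH 1%N)) | rewrite hornerC].
apply: henselization_sub => //.
  apply: (henselian_pth_root pchar hcl (subH 1%N) _ hM sub) => [|a [f hf ->]].
    exact: henselian_henselization.
  rewrite -horner_Frobenius; apply: (coefs_in_horner (subH 1%N)) => // i.
  by rewrite coef_map /= pFrobenius_autE; apply: (sfX (subH 1%N)).
apply: adjoin1_sub => // [a Ka|/=].
  by apply: sub; apply: KH.
by exists 'X; [exact: (coefs_inX (subH 1%N)) | rewrite hornerX expn0 expr1].
Qed.

Lemma pth_power_descent L y m : subfield L -> henselian v L -> K `<=` L -> L y ->
  H 0 y -> ~ H 1 y -> L (x ^+ (p ^ m)) -> L x.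
Proof.
move=> hL hH KL Ly H0y H1y.
have xp : H 1 (x ^+ p) by have := @xH 1%N; rewrite expn1.
have [f0 hf0 ey0] := H0_simple H0y.
have [f [hf sf ef]] := reduce_simple_pth pchar (subH 1%N) xp hf0.
(* A constant [f] would put [y] into [H 1]. *)
have s1 : (1 < size f)%N.
  rewrite ltnNge; apply/negP => /size1_polyC ec; apply: H1y.
  by rewrite ey0 ef ec hornerC; apply: hf.
have tower j : exists f, [/\ coefs_in (H j.+1) f, (1 < size f)%N, (size f <= p)%N &
    y ^+ (p ^ j) = f.[x ^+ (p ^ j)]].
  elim: j => [|j [g [hg sg1 sgp eg]]].
    by exists f; rewrite expn0 !expr1 ey0 ef.
  exists (map_poly (pFrobenius_aut pchar) g).
  rewrite size_map_poly; split=> //.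
    by move=> i; rewrite coef_map /= pFrobenius_autE; apply: pthH.
  by rewrite !expnSr !exprM horner_Frobenius eg.
elim: m => [|m IHm]; first by rewrite expn0 expr1.
move=> Lx; apply: IHm.
(* From [x ^+ (p ^ m.+1)] in [L] it follows that [g - y ^+ (p ^ m)] is over [L]; it is nonzero of
   degree below [p] and has the root [x ^+ (p ^ m)]. *)
have HL : H m.+1 `<=` L.
  by apply: henselization_sub => //; apply: adjoin1_sub.
have [g [hg sg1 sgp eg]] := tower m.
have sgy : size (g - (y ^+ (p ^ m))%:P) = size g.
  by rewrite size_polyDl // size_polyN (leq_ltn_trans (size_polyC_leq1 _)).
apply: (pth_root_mem_size pchar hL (f := g - (y ^+ (p ^ m))%:P)).
- by rewrite -exprM -expnSr.
- apply: (coefs_inB hL); first by move=> i; apply: HL.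
  by apply: (coefs_inC hL); apply: (sfX hL).
- by rewrite rootE hornerD hornerN hornerC -eg subrr.
- by rewrite -size_poly_gt0 sgy ltnW.
- by rewrite sgy.
Qed.

End Pchar.

Lemma mem_of_close L y t : t != 0 -> dlt 1 t -> archimedean_valuation v ->
  subfield L -> henselian v L -> K `<=` L -> L y -> cofinal_val v L ->
  dlt d (x - y) -> henselization v (adjoin K [set x]) y -> L x.
Proof.
move=> t0 t1 harch hL hH KL Ly hc dxy Hy.
have hKx := subfield_adjoin K [set x].
have Cx : vclosure v L x.
  apply: (vclosure_generator hL hH KL Ly dxy).
  exact: (henselization_vclosure t0 t1 hcl harch hKx Hy).
have Ax : algebraic_over L x.
  apply: (algebraic_exchange hL KL Ly).
    exact: (henselization_algebraic hcl hKx Hy).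
  by apply: far_transcendental; apply: dltW.
have [//|[p pchar [m Lxm]]] := vclosure_algebraic hcl hL hH hc Ax Cx.
apply: (pth_power_descent pchar hL hH KL Ly _ _ Lxm).
  by rewrite expn0 expr1.
rewrite expn1 => /(henselization_vclosure t0 t1 hcl harch (subfield_adjoin _ _)).
by apply: (adjoin_pth_not_close pchar); apply: dltW.
Qed.

End Descent.

(** * Choice of [gamma] and of a generator in [F] *)

Theorem theorem11p1 (Om : fieldType) (G : orderedGroupType)
    (v : valuation Om G) (K F : set Om) (x : Om)
    (hK : subfield K)
    (hrank : rank_one v K)
    (hF : function_field_trdeg_one K F)
    (himm : immediate_ext v K F)
    (hOm : is_algebraic_closure_of F)
    (hxF : henselization v F x)
    (hxK : notin_completion v K x)
    (hx : transcendental_appr v x K)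
    (hxh : henselization v F = henselization v (adjoin K [set x])) :
  (exists2 y, F y & henselization v F = henselization v (adjoin K [set y])) /\
  (exists2 gamma, value_group v K gamma &
     forall y, F y -> vle (Some gamma) (v (x - y)) ->
       henselization v (adjoin K [set x]) = henselization v (adjoin K [set y])).
Proof.
have [hcl halg] := hOm; have [hFs KF _ _] := hF.
have harch := rank_one_archimedean hK hFs hrank himm.1 halg.
have [g0 [d Kd vd] hd] := hxK.
have d0 : d != 0 by apply/eqP => e; move: vd; rewrite e valf0.
have far f a : coefs_in K f -> f != 0 -> root f a -> val_lt v (x - a) d.
  (* Some [c] in [K] is at least as close to [x] as the root [a], and [v (x - c) < v d]. *)
  move=> Kf f0 ra; have [c Kc hc] := appr_root_bound hcl hK hx Kf f0 ra.
  by apply: dle_lt_trans hc _; rewrite /val_lt vd; apply: hd.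
have [t Kt [t0 t1]] : exists2 t, K t & t != 0 /\ val_lt v 1 t.
  have [[h [a Ka va] h0] _] := hrank.
  have a0 : a != 0 by apply/eqP => e; move: va; rewrite e valf0.
  have [ha|] := boolP (val_lt v 1 a); first by exists a.
  rewrite -dleNlt => ha; exists a^-1; first exact: sfV.
  rewrite invr_eq0; split=> //; rewrite -[a^-1]mul1r dlt_divr // mulr1 dltNle.
  apply/negP => h1; have := vle_anti ha h1; rewrite va valf1 => -[e].
  exact: h0.
have cofinal L : K `<=` L -> cofinal_val v L.
  move=> KL b b0; have [n hn] := harch _ _ t1 b0.
  have tn0 m : t ^+ m != 0 by rewrite expf_neq0.
  exists (t ^+ n.+1); first by apply: KL; exact: sfX.
  by split=> //; apply: (dle_lt_trans hn); rewrite exprSr; apply: dlt_mulr.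
(* The factor [t] of positive value turns the weak inequality into [v (x - y) > v d]; thus
   [gamma = v (d * t)]. *)
have close y : F y -> val_le v (d * t) (x - y) ->
    henselization v (adjoin K [set x]) = henselization v (adjoin K [set y]).
  move=> Fy hy; rewrite eqEsubset; split; last first.
    rewrite -hxh; apply: henselization_mono => //.
    apply: subset_trans (@sub_henselization _ _ v F).
    exact: adjoin1_sub.
  apply: henselization_mono => //.
  have hL := subfield_henselization v (adjoin K [set y]).
  have KL : K `<=` henselization v (adjoin K [set y]).
    by move=> a Ka; apply: sub_henselization; apply: sub_adjoinl.
  apply: adjoin1_sub => //.
  apply: (@mem_of_close _ _ v K x d hcl hK d0 Kd far _ y t) => //.
  - exact: henselian_henselization.
  - by apply: sub_henselization; apply: mem_adjoin1.
  - exact: cofinal.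
  - by apply: dlt_le_trans hy; apply: dlt_mulr.
  - by rewrite -hxh; apply: sub_henselization.
have dt0 : d * t != 0 by rewrite mulf_neq0.
split.
  (* In rank one [F^h] lies in the closure of [F], so some [y] in [F] is close enough to [x]. *)
  have [y Fy hy] := henselization_vclosure t0 t1 hcl harch hFs hxF dt0.
  by exists y => //; rewrite hxh; apply: close.
have [g vg] := valf_neq0 v dt0.
exists g; first by exists (d * t) => //; exact: sfM.
by move=> y Fy hy; apply: close => //; rewrite /val_le vg.
Qed.
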